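(* Let $f:\mathbb{R}^d\to\mathbb{R}^d$ and $g:\mathbb{R}^d\to\mathbb{R}^{d\times m}$. Suppose that there exist constants $K_3<-\frac12$ and $K_4>0$ with $K_4+2K_3<-1$ such that $$(x-y)^{\mathrm T}(f(x)-f(y))\le K_3|x-y|^2\quad\text{and}\quad |g(x)-g(y)|^2\le K_4|x-y|^2$$ for all $x,y\in\mathbb{R}^d$. Then for any fixed $\Delta t\in(0,1)$, the numerical solution $\{X_i\}_{i\ge0}$ of the semi-implicit Euler-Maruyama method $$X_{i+1}=X_i+f(X_{i+1})\Delta t+g(X_i)\Delta B_{i+1}+\Delta L_{i+1},\quad i=0,1,2,\dots,$$ has a unique invariant measure $\Pi_{\Delta t}$.
   Context: $|\cdot|$ is the Euclidean norm on $\mathbb{R}^d$ (and the Frobenius norm for matrices). $B$ is an $m$-dimensional Brownian motion. $L$ is a $d$-dimensional Lévy process, independent of $B$, with Lévy triplet $(0,0,\nu)$, i.e. $\mathbb{E}[e^{i\theta\cdot L(t)}]=\exp\left(t\int_{\mathbb{R}^d\setminus\{0\}}(e^{i\theta\cdot z}-1-i\theta\cdot z\,1_{\{|z|<1\}})\,\nu(dz)\right)$, where $\nu$ is a $\sigma$-finite measure with $\int_{\mathbb{R}^d\setminus\{0\}}\min(1,|z|^2)\,\nu(dz)<\infty$, satisfying $\int_{|z|<1}|z|^{\gamma_0}\nu(dz)<\infty$ with $\gamma_0\in[1,2]$ and $\int_{|z|\ge1}|z|^{\gamma_\infty}\nu(dz)<\infty$ with $\gamma_\infty>1$; moreover $L(t)$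 has finite moments of every order and $\mathbb{E}(L(t))=0$. Here $t_i=i\Delta t$, $\Delta B_{i+1}=B(t_{i+1})-B(t_i)$, $\Delta L_{i+1}=L(t_{i+1})-L(t_i)$. Let $\mathcal P(\mathbb{R}^d)$ be the family of all probability measures on $\mathbb{R}^d$ and $\mathbb{P}_i(\cdot,\cdot)$ the ($i$-step) transition probability kernel of $\{X_i\}_{i\ge0}$. A measure $\Pi_{\Delta t}\in\mathcal P(\mathbb{R}^d)$ is called an invariant measure of the numerical solution if $\Pi_{\Delta t}(A)=\int_{\mathbb{R}^d}\mathbb{P}_i(x,A)\,\Pi_{\Delta t}(dx)$ for all $i=0,1,2,\dots$ and all Borel sets $A\subset\mathbb{R}^d$. *)

(* Defs.v *)
From HB Require Import structures.
From mathcomp Require Import all_boot all_order all_algebra.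
From mathcomp Require Import all_classical all_reals all_analysis.
From mathcomp Require Import complex.

Set Implicit Arguments.
Unset Strict Implicit.
Unset Printing Implicit Defensive.

Import Order.TTheory GRing.Theory Num.Theory.
Import numFieldNormedType.Exports.

Local Open Scope classical_set_scope.
Local Open Scope ring_scope.

(* Matrices, in particular the column vectors modelling R^d, carry the Borel
   sigma-algebra. *)
HB.instance Definition _ (R : realType) (m n : nat) :=
  @isMeasurable.Build (sigma_display (@open 'M[R]_(m, n))) 'M[R]_(m, n)
    <<s @open 'M[R]_(m, n) >> (@sigma_algebra0 _ setT _)
    (@sigma_algebraC _ _) (@sigma_algebra_bigcup _ setT _).

(* The library norm on matrices is the max norm; this is the Euclidean norm on
   column vectors and the Frobenius norm in general. *)
Definition enorm (R : realType) (m n : nat) (M : 'M[R]_(m, n)) : R :=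
  Num.sqrt (\sum_(i < m) \sum_(j < n) M i j ^+ 2).

Definition dotv (R : realType) (d : nat) (x y : 'cV[R]_d) : R :=
  (x^T *m y) 0 0.

Definition cexp (R : realType) (z : R[i]) : R[i] :=
  Complex (expR (complex.Re z) * cos (complex.Im z))
          (expR (complex.Re z) * sin (complex.Im z)).

Definition cintegral (d : measure_display) (T : measurableType d)
    (R : realType) (mu : {measure set T -> \bar R}) (D : set T)
    (F : T -> R[i]) : R[i] :=
  Complex (\int[mu]_(x in D) complex.Re (F x))
          (\int[mu]_(x in D) complex.Im (F x)).

Section processes.
Context {d : measure_display} {T : measurableType d} {R : realType}.
Variable P : probability T R.

(* Letting some A i be the full space gives the product rule for every
   subfamily. *)
Definition mutually_independent (k n : nat) (Y : 'I_k -> T -> 'cV[R]_n) :=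
  forall A : 'I_k -> set 'cV[R]_n, (forall i, measurable (A i)) ->
    P (\bigcap_(i in [set: 'I_k]) (Y i @^-1` A i)) =
    (\prod_(i < k) P (Y i @^-1` A i))%E.

(* Processes are indexed by R, but only times t >= 0 are relevant. *)
Definition process_sigma (n : nat) (X : R -> T -> 'cV[R]_n) : set (set T) :=
  <<s \bigcup_(t in [set t | 0 <= t])
        preimage_set_system setT (X t) measurable >>.

Definition independent_processes (n k : nat)
    (X : R -> T -> 'cV[R]_n) (Y : R -> T -> 'cV[R]_k) :=
  forall E F, process_sigma X E -> process_sigma Y F ->
    P (E `&` F) = (P E * P F)%E.

Definition independent_increments (n : nat) (X : R -> T -> 'cV[R]_n) :=
  forall (k : nat) (t : nat -> R), 0 <= t 0%N ->
    (forall i, (i < k)%N -> t i <= t i.+1) ->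
    mutually_independent (fun (i : 'I_k) w => X (t i.+1) w - X (t i) w).

Record brownian_motion (m : nat) (B : R -> T -> 'cV[R]_m) : Prop := {
  bm_measurable : forall t, 0 <= t -> measurable_fun setT (B t) ;
  bm_start : {ae P, forall w, B 0 w = 0} ;
  bm_increments : independent_increments B ;
  bm_gaussian : forall s t, 0 <= s -> s < t ->
    forall A : 'I_m -> set R, (forall j, measurable (A j)) ->
    P [set w | forall j, A j ((B t w - B s w) j 0)] =
    (\prod_(j < m) normal_prob 0 (Num.sqrt (t - s)) (A j))%E ;
  bm_continuous :
    {ae P, forall w, {within `[0, +oo[, continuous (fun t => B t w)}}
}.

Record levy_process (n : nat) (L : R -> T -> 'cV[R]_n) : Prop := {
  levy_measurable : forall t, 0 <= t -> measurable_fun setT (L t) ;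
  levy_start : {ae P, forall w, L 0 w = 0} ;
  levy_increments : independent_increments L ;
  levy_stationary : forall s t, 0 <= s -> s <= t ->
    forall A, measurable A ->
    P [set w | A (L t w - L s w)] = P [set w | A (L (t - s) w)] ;
  levy_stoch_continuous : forall (eps s : R), 0 < eps -> 0 <= s ->
    P [set w | eps < enorm (L t w - L s w)] @[t --> within `[0, +oo[ (nbhs s)]
      --> 0%E
}.

(* nu lives on R^n \ {0}: its mass at 0, if any, is never looked at. *)
Definition levy_measure (n : nat) (nu : {measure set 'cV[R]_n -> \bar R}) :=
  sigma_finite ([set~ 0] : set 'cV[R]_n) nu /\
  (\int[nu]_(z in [set~ 0%R]) (Num.min 1 (enorm z ^+ 2))%:E < +oo)%E.

(* Characteristic function of a Levy process with triplet (0, 0, nu). *)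
Definition levy_triplet00 (n : nat) (L : R -> T -> 'cV[R]_n)
    (nu : {measure set 'cV[R]_n -> \bar R}) :=
  forall (t : R) (theta : 'cV[R]_n), 0 <= t ->
    cintegral P setT (fun w => cexp (Complex 0 (dotv theta (L t w)))) =
    cexp (Complex t 0 *
      cintegral nu [set~ 0] (fun z =>
        cexp (Complex 0 (dotv theta z)) - 1 -
        Complex 0 (dotv theta z * \1_[set z : 'cV[R]_n | enorm z < 1] z))).

(* X is a version of the numerical solution with initial value x; the scheme is
   implicit, so X is characterised by the recursion rather than computed. *)
Record semi_implicit_EM (n m : nat)
    (f : 'cV[R]_n -> 'cV[R]_n) (g : 'cV[R]_n -> 'M[R]_(n, m))
    (B : R -> T -> 'cV[R]_m) (L : R -> T -> 'cV[R]_n) (dt : R)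
    (x : 'cV[R]_n) (X : nat -> T -> 'cV[R]_n) : Prop := {
  em_measurable : forall i, measurable_fun setT (X i) ;
  em_start : {ae P, forall w, X 0%N w = x} ;
  em_step : forall i, {ae P, forall w,
    X i.+1 w = X i w + dt *: f (X i.+1 w)
      + g (X i w) *m (B (i.+1%:R * dt) w - B (i%:R * dt) w)
      + (L (i.+1%:R * dt) w - L (i%:R * dt) w)}
}.

(* X x is the solution started at x; this is the i-step kernel P_i(x, A). *)
Definition transition (n : nat) (X : 'cV[R]_n -> nat -> T -> 'cV[R]_n)
    (i : nat) (x : 'cV[R]_n) (A : set 'cV[R]_n) : \bar R :=
  P (X x i @^-1` A).

End processes.

Definition invariant_measure (R : realType) (n : nat)
    (K : nat -> 'cV[R]_n -> set 'cV[R]_n -> \bar R)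
    (Pi : probability 'cV[R]_n R) :=
  forall (i : nat) (A : set 'cV[R]_n), measurable A ->
    Pi A = (\int[Pi]_x K i x A)%E.

(* Main.v *)
(* The scheme reads X_{i+1} = F(X_i, xi_i), where the noise xi_i = (dB_i, dL_i)
   is i.i.d. and F(x, (b, l)) solves z - dt f(z) = x + g(x) b + l for z. One-sided
   Lipschitz continuity of f makes z |-> z - dt f(z) expand distances by
   1 - K3 dt, and dB has independent centred coordinates of variance dt, so that
   E|F(x, xi) - F(y, xi)| <= s |x - y| with s = (1 + K4 dt / 2) / (1 - K3 dt) < 1.
   For such maps the backward iterates F(., xi_0) o ... o F(., xi_{k-1})(0)
   form almost surely a Cauchy sequence, and they have the same law as the k-th
   step of the chain started at 0. The law of their limit is invariant, and the
   k-step kernels converge to it from every starting point when tested against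
   bounded Lipschitz functions, which gives uniqueness. *)
Require Import Defs.
From HB Require Import structures.
From mathcomp Require Import all_boot all_order all_algebra.
From mathcomp Require Import all_classical all_reals all_analysis.
From mathcomp Require Import complex measurable_realfun.
From mathcomp Require Import ring lra.
Import Order.TTheory GRing.Theory Num.Theory.
Import numFieldNormedType.Exports.
Local Open Scope classical_set_scope.
Local Open Scope ring_scope.

(** * Euclidean norm and Borel sets of matrices *)

(** Since [f] need not be continuous, the implicit equation for z may have no solution for some
    noise values. What is available is that [X x] solves it almost surely, for each start x
    separately, with a null set that depends on x. The random map therefore has to be total and
    jointly measurable in state and noise: it is built from a Lipschitz left inverse of z - dt f(z),
    and it agrees with [X x] almost surely. As a vector map this extension is not known to have
    Lipschitz constant 1 / (1 - K3 dt), so the contraction estimate is carried out on the true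
    solutions, outside a null set. The Levy increments cancel in the difference of two solutions,
    which leaves u = x - y + (g(x) - g(y)) dB. With a = |x - y|, the constant s comes from |u| <=
    a/2 + |u|^2/(2a) and E|u|^2 <= (1 + K4 dt) a^2. The bound s < 1 amounts to K4 + 2 K3 < 0, which
    follows from K4 + 2 K3 < -1. Contraction in mean controls Lipschitz functions but not
    indicators; hence the detour through test functions that determine a law. *)

Section euclidean_norm.
Context {R : realType}.

Lemma enorm_ge0 (m n : nat) (M : 'M[R]_(m, n)) : 0 <= enorm M.
Proof. exact: sqrtr_ge0. Qed.

Lemma sqr_enorm (m n : nat) (M : 'M[R]_(m, n)) :
  enorm M ^+ 2 = \sum_(i < m) \sum_(j < n) M i j ^+ 2.
Proof.
rewrite sqr_sqrtr// !sumr_ge0// => i _.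
by rewrite sumr_ge0// => j _; rewrite sqr_ge0.
Qed.

Lemma ler_enorm (m n : nat) (M : 'M[R]_(m, n)) i j : `|M i j| <= enorm M.
Proof.
rewrite -sqrtr_sqr ler_wsqrtr// (bigD1 i)//= (bigD1 j)//= -addrA lerDl addr_ge0//.
  by rewrite sumr_ge0// => k _; rewrite sqr_ge0.
by rewrite sumr_ge0// => k _; rewrite sumr_ge0// => l _; rewrite sqr_ge0.
Qed.

Lemma enorm0_eq0 (m n : nat) (M : 'M[R]_(m, n)) : enorm M = 0 -> M = 0.
Proof.
move=> M0; apply/matrixP => i j; rewrite mxE; apply/eqP.
by rewrite -normr_le0 -M0 ler_enorm.
Qed.

Lemma enorm_col (n : nat) (x : 'cV[R]_n) : enorm x ^+ 2 = \sum_(i < n) x i 0 ^+ 2.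
Proof. by rewrite sqr_enorm; apply: eq_bigr => i _; rewrite big_ord1. Qed.

Lemma dotvE (n : nat) (x y : 'cV[R]_n) : dotv x y = \sum_(i < n) x i 0 * y i 0.
Proof. by rewrite /dotv mxE; apply: eq_bigr => i _; rewrite mxE. Qed.

Lemma dotvv (n : nat) (x : 'cV[R]_n) : dotv x x = enorm x ^+ 2.
Proof. by rewrite dotvE enorm_col; apply: eq_bigr => i _; rewrite expr2. Qed.

Lemma dotvDr (n : nat) (x y z : 'cV[R]_n) : dotv x (y + z) = dotv x y + dotv x z.
Proof. by rewrite /dotv mulmxDr mxE. Qed.

Lemma dotvDl (n : nat) (x y z : 'cV[R]_n) : dotv (x + y) z = dotv x z + dotv y z.
Proof. by rewrite /dotv linearD mulmxDl mxE. Qed.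

Lemma dotvZr (n : nat) a (x y : 'cV[R]_n) : dotv x (a *: y) = a * dotv x y.
Proof. by rewrite /dotv -scalemxAr mxE. Qed.

Lemma dotvZl (n : nat) a (x y : 'cV[R]_n) : dotv (a *: x) y = a * dotv x y.
Proof. by rewrite /dotv linearZ/= -scalemxAl mxE. Qed.

Lemma dotvC (n : nat) (x y : 'cV[R]_n) : dotv x y = dotv y x.
Proof. by rewrite !dotvE; apply: eq_bigr => i _; rewrite mulrC. Qed.

(** The square of the norm of |y| x - |x| y expands to 2 |x| |y| (|x| |y| - x.y); the positive
    factors are then divided out. *)
Lemma cauchy_schwarz (n : nat) (x y : 'cV[R]_n) : dotv x y <= enorm x * enorm y.
Proof.
have [/eqP x0|xn0] := boolP (enorm x == 0).
  by rewrite x0 mul0r (enorm0_eq0 _ _ _ x0) dotvE big1// => i _; rewrite mxE mul0r.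
have [/eqP y0|yn0] := boolP (enorm y == 0).
  by rewrite y0 mulr0 (enorm0_eq0 _ _ _ y0) dotvE big1// => i _; rewrite mxE mulr0.
have a0 : 0 < enorm x by rewrite lt_neqAle eq_sym xn0 enorm_ge0.
have b0 : 0 < enorm y by rewrite lt_neqAle eq_sym yn0 enorm_ge0.
have : 0 <= enorm (enorm y *: x - enorm x *: y) ^+ 2 by exact: sqr_ge0.
rewrite -dotvv -scaleNr dotvDr !dotvDl !dotvZr !dotvZl !dotvv (dotvC _ y x) => h.
have : 0 <= (enorm x * enorm y) * (enorm x * enorm y - dotv x y).
  rewrite -(@pmulr_rge0 _ 2)//; apply: (le_trans h).
  by rewrite le_eqVlt; apply/orP; left; apply/eqP; ring.
by rewrite pmulr_rge0 ?mulr_gt0// subr_ge0.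
Qed.

Lemma enormN (m n : nat) (M : 'M[R]_(m, n)) : enorm (- M) = enorm M.
Proof.
rewrite /enorm; congr Num.sqrt; apply: eq_bigr => i _; apply: eq_bigr => j _.
by rewrite mxE sqrrN.
Qed.

Lemma enormB (m n : nat) (M N : 'M[R]_(m, n)) : enorm (M - N) = enorm (N - M).
Proof. by rewrite -enormN opprB. Qed.

Lemma enorm_triangle (n : nat) (x y : 'cV[R]_n) : enorm (x + y) <= enorm x + enorm y.
Proof.
rewrite -(@ler_pXn2r _ 2)// ?nnegrE ?addr_ge0 ?enorm_ge0//.
rewrite -dotvv dotvDr !dotvDl !dotvv (dotvC _ y x) sqrrD.
have := cauchy_schwarz _ x y; lra.
Qed.

Lemma enorm0 (m n : nat) : enorm (0 : 'M[R]_(m, n)) = 0.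
Proof.
rewrite /enorm big1 ?sqrtr0// => i _; rewrite big1// => j _.
by rewrite mxE expr0n.
Qed.

Lemma enorm_delta (n : nat) (i : 'I_n) (a : R) : enorm (a *: (delta_mx i 0 : 'cV[R]_n)) = `|a|.
Proof.
rewrite -sqrtr_sqr; congr Num.sqrt; rewrite (bigD1 i)//= big_ord1 !mxE !eqxx mulr1.
rewrite big1 ?addr0// => j /negPf ji; rewrite big_ord1 !mxE ji/= mulr0 expr0n//.
Qed.

Lemma enorm_le_sum (n : nat) (x : 'cV[R]_n) : enorm x <= \sum_(i < n) `|x i 0|.
Proof.
rewrite {1}(matrix_sum_delta x).
under eq_bigr do rewrite big_ord1.
elim/big_rec2: _ => [|i a v _ h]; first by rewrite enorm0.
by apply: (le_trans (enorm_triangle _ _ _)); rewrite enorm_delta lerD2l.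
Qed.

End euclidean_norm.

(** * Borel measurability of maps to and from matrices *)

Section matrix_measurability.
Context {R : realType}.

(** Exchanging x and y makes the bound two-sided, so [u] is continuous for the max norm. This one
    criterion serves the norm, the test functions, the implicit solver and the entries of [g]. *)
Lemma enorm_lipschitz_measurable (n : nat) (u : 'cV[R]_n -> R) (c : R) :
  (forall x y, u x <= u y + c * enorm (x - y)) -> measurable_fun setT u.
Proof.
move=> uL; have cu : continuous u.
  move=> x; apply/(@cvgrPdist_lt _ R^o _ (nbhs (x : 'cV[R]_n)) (nbhs_filter x)) => /= e e0.
  (* The added 1 keeps the denominator positive and makes the final inequality strict. *)
  pose r := e / (`|c| * n%:R + 1).
  have d0 : 0 < `|c| * n%:R + 1 by rewrite ltr_wpDl// mulr_ge0.
  have r0 : 0 < r by rewrite divr_gt0.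
  apply/nbhs_ballP; exists r => //= y xy.
  have h z t : u z - u t <= `|c| * enorm (z - t).
    rewrite lerBlDl (le_trans (uL z t))// lerD2l ler_wpM2r ?enorm_ge0//.
    exact: ler_norm.
  have {}h : `|u x - u y| <= `|c| * enorm (x - y).
    by rewrite ler_norml h andbT lerNl opprB (le_trans (h _ _))// enormB.
  apply: (le_lt_trans h).
  have xyr : enorm (x - y) <= n%:R * r.
    apply: (le_trans (enorm_le_sum _ _)).
    rewrite -[n in n%:R]card_ord mulr_natl -sumr_const ler_sum// => i _.
    by rewrite !mxE; case: xy => _ /(_ i 0) /ltW.
  apply: (@le_lt_trans _ _ (`|c| * (n%:R * r))); first by rewrite ler_wpM2l.
  rewrite mulrA /r mulrA ltr_pdivrMr// mulrDr mulr1 [ltLHS]mulrC ltrDl//.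
apply: (measurability _ (RGenOpens.measurableE R)) => /= _ [A oA <-].
move: oA => [a [b ->]]; rewrite setTI; apply: sub_sigma_algebra.
have /continuousP := cu; apply; exact: interval_open.
Qed.

Lemma coord_measurable (m n : nat) i j :
  measurable_fun setT (fun M : 'M[R]_(m, n) => M i j).
Proof.
apply: (measurability _ (RGenOpens.measurableE R)) => /= _ [A oA <-].
rewrite setTI; apply: sub_sigma_algebra.
have /continuousP := @coord_continuous R m n i j; apply.
by case: oA => x [y ->]; exact: interval_open.
Qed.

(** Boxes [C q] with rational centre and radius 1/(k+1) form a countable base of the topology, so
    the preimage of an open set is a countable union of finite intersections of coordinate
    events. *)
Lemma measurable_mx d (T : measurableType d) (m n : nat) (f : T -> 'M[R]_(m, n)) :
  (forall i j, measurable_fun setT (fun t => f t i j)) -> measurable_fun setT f.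
Proof.
move=> mf; apply: (@measurability _ _ T 'M[R]_(m, n) setT f
  (@open 'M[R]_(m, n)) erefl) => /= _ [U oU <-]; rewrite setTI.
pose C (q : 'M[rat]_(m, n) * nat) : set 'M[R]_(m, n) :=
  [set M | forall i j, `|M i j - ratr (q.1 i j)| < q.2.+1%:R^-1].
have mC q : measurable (f @^-1` C q).
  have -> : f @^-1` C q = \big[setI/setT]_(i < m) \big[setI/setT]_(j < n)
      ((fun t => f t i j - ratr (q.1 i j)) @^-1` [set r | `|r| < q.2.+1%:R^-1]).
    apply/seteqP; split=> [t /= Ct|t].
      rewrite -bigcap_seq => i _/=; rewrite -bigcap_seq => j _/=; exact: Ct.
    rewrite -bigcap_seq => /= Ct i j.
    by have := Ct i (mem_index_enum _); rewrite -bigcap_seq => /(_ j (mem_index_enum _)).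
  apply: bigsetI_measurable => i _; apply: bigsetI_measurable => j _.
  have mg : measurable_fun setT (fun t => f t i j - ratr (q.1 i j)).
    exact: measurable_funB.
  rewrite -[X in measurable X]setTI; apply: mg => //.
  have -> : [set r : R | `|r| < q.2.+1%:R^-1] =
     `]-(q.2.+1%:R^-1), (q.2.+1%:R^-1)[%classic.
    by apply/seteqP; split=> r /=; rewrite in_itv/= ltr_norml.
  exact: measurable_itv.
have -> : f @^-1` U =
    \bigcup_(q in [set q | C q `<=` U]) (f @^-1` C q).
  apply/seteqP; split=> [t Ut|t [q qU Cq]]; last exact: qU.
  have /nbhs_ballP[e /= e0 eU] : nbhs (f t) U by exact: open_nbhs_nbhs.
  (* Two radii must fit into [e]: one from [f t] to the rational centre, one from the centre to a
     point of the box. *)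
  have [k ke] : exists k : nat, k.+1%:R^-1 + k.+1%:R^-1 < e.
    have e20 : 0 < e / 2 by rewrite divr_gt0.
    exists (Num.truncn (e / 2)^-1).
    have : (Num.truncn (e / 2)^-1).+1%:R^-1 < e / 2.
      by rewrite invf_plt ?posrE//; exact: truncnS_gt.
    by move=> h; rewrite [ltRHS]splitr ltrD.
  have k0 : 0 < k.+1%:R^-1 :> R by rewrite invr_gt0.
  have /choice[q qE] : forall ij : 'I_m * 'I_n, exists q : rat,
      `|f t ij.1 ij.2 - ratr q| < k.+1%:R^-1.
    move=> [i j]; have : f t i j - k.+1%:R^-1 < f t i j + k.+1%:R^-1.
      by rewrite ltrD2l gtrN.
    move=> /rat_in_itvoo[q]; rewrite in_itv/= => /andP[h1 h2].
    exists q => /=; rewrite distrC ltr_norml ltrBlDl h2 andbT ltrBrDl.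
    by [].
  exists (\matrix_(i, j) q (i, j), k) => /=; last first.
    by move=> i j/=; rewrite mxE; exact: (qE (i, j)).
  have e0' : 0 < e by [].
  move=> M /= CM; apply: eU; split => // i j; rewrite /ball/=.
  have := CM i j; rewrite mxE; have /= := qE (i, j).
  move: (q _) => r h1 h2; apply: le_lt_trans ke.
  rewrite -(subrKA (ratr r)) (le_trans (ler_normD _ _))// lerD// ?ltW//.
  by rewrite distrC.
rewrite bigcup_mkcond; apply: countable_bigcupT_measurable => // q.
by case: ifPn.
Qed.

Lemma measurable_enorm (n : nat) : measurable_fun setT (@enorm R n 1).
Proof.
apply: (@enorm_lipschitz_measurable _ _ 1) => x y; rewrite mul1r.
by have := enorm_triangle _ y (x - y); rewrite addrC subrK.
Qed.

End matrix_measurability.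

(** * Independence *)

Section independence.
Context {d d1 d2} {T : measurableType d} {E1 : measurableType d1}
  {E2 : measurableType d2} {R : realType} (P : probability T R).
Local Open Scope ereal_scope.

(** Independence identifies the joint law with the product of the marginal laws, after which Tonelli
    integrates out [Y] with [Z] frozen. *)
Lemma independent_tonelli (Y : T -> E1) (Z : T -> E2) :
  measurable_fun setT Y -> measurable_fun setT Z ->
  (forall A B, measurable A -> measurable B ->
    P (Y @^-1` A `&` Z @^-1` B) = P (Y @^-1` A) * P (Z @^-1` B)) ->
  forall H : E1 * E2 -> \bar R, measurable_fun setT H -> (forall z, 0 <= H z) ->
  \int[P]_w H (Y w, Z w) = \int[P]_w' \int[P]_w H (Y w, Z w').
Proof.
move=> mY mZ YZ H mH H0.
pose Y' : {mfun T >-> E1} := HB.pack Y (isMeasurableFun.Build _ _ _ _ _ mY).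
pose Z' : {mfun T >-> E2} := HB.pack Z (isMeasurableFun.Build _ _ _ _ _ mZ).
have mYZ : measurable_fun setT (fun w => (Y w, Z w)) by exact: measurable_fun_pair.
pose YZ' : {mfun T >-> (E1 * E2)%type} :=
  HB.pack (fun w => (Y w, Z w)) (isMeasurableFun.Build _ _ _ _ _ mYZ).
rewrite -[LHS](ge0_integral_distribution (YZ' : {RV P >-> _}))//.
rewrite (@eq_measure_integral _ _ _ _
  (distribution P Y' \x distribution P Z')); last first.
  by move=> A mA _; apply/esym; exact: product_measure_unique.
rewrite fubini_tonelli2//.
rewrite (@ge0_integral_distribution _ _ _ _ _ P Z' (fubini_G _ _))/=; last 2 first.
- exact: measurable_fun_fubini_tonelli_G.
- by move=> y; exact: integral_ge0.
apply: eq_integral => w' _ /=; rewrite /fubini_G.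
rewrite (@ge0_integral_distribution _ _ _ _ _ P Y' (fun x => H (x, Z w')))//.
exact: measurableT_comp.
Qed.

End independence.

Section independence_of_sigma_algebras.
Context {d} {T : measurableType d} {R : realType} (P : probability T R).
Local Open Scope ereal_scope.

(** Both A |-> P(A [&] D) and A |-> P(D) P(A) are finite measures that agree on the pi-system [G],
    hence on the sigma-algebra it generates. *)
Let independent_l (G : set (set T)) (D : set T) :
  setI_closed G -> G setT -> G `<=` measurable -> measurable D ->
  (forall A, G A -> P (A `&` D) = P A * P D) ->
  forall A, <<s G >> A -> P (A `&` D) = P A * P D.
Proof.
move=> GI GT Gm mD h A sA.
have PDfin : P D \is a fin_num by exact: fin_num_measure.
pose r : {nonneg R} := NngNum (fine_ge0 (measure_ge0 P D)).
have -> : P (A `&` D) = mrestr P mD A by [].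
have -> : P A * P D = mscale r P A by rewrite /mscale/= fineK// muleC.
apply: (@g_sigma_algebra_measure_unique _ _ _ G Gm (fun=> setT) _ _
  (mrestr P mD) (mscale r P)) => //.
- by rewrite bigcup_const.
- by move=> B GB; rewrite /mrestr/= /mscale/= fineK// muleC; exact: h.
- by move=> n; apply: (@le_lt_trans _ _ 1) (ltry 1); rewrite /= /mrestr setTI probability_le1.
Qed.

(** The one-sided extension is applied twice, once in each argument. *)
Lemma independent_sigma (G H : set (set T)) :
  setI_closed G -> G setT -> G `<=` measurable ->
  setI_closed H -> H setT -> H `<=` measurable ->
  (forall A B, G A -> H B -> P (A `&` B) = P A * P B) ->
  forall A B, <<s G >> A -> <<s H >> B -> P (A `&` B) = P A * P B.
Proof.
move=> GI GT Gm HI HT Hm GH A B sA sB.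
have mA : measurable A.
  by move: A sA; apply: smallest_sub => //; exact: sigma_algebra_measurable.
rewrite setIC muleC; apply: (independent_l H) => // C HC.
rewrite setIC muleC; apply: (independent_l G) => //; first exact: Hm.
by move=> D GD; exact: GH.
Qed.

End independence_of_sigma_algebras.

(** * Bounded Lipschitz test functions *)

Section inf_convolution.
Context {R : realType} (n : nat) {I : Type} (a : I -> R) (p : I -> 'cV[R]_n) (c : R).

(** McShane's formula for a [c]-Lipschitz function from the data [a i] at the points [p i]. It is
    used both to approximate indicators of open sets and to invert the implicit step. *)
Definition inf_convolution (y : 'cV[R]_n) : R :=
  inf (range (fun i => a i + c * enorm (y - p i))).

Hypothesis lb : forall y, has_lbound (range (fun i => a i + c * enorm (y - p i))).

Lemma inf_convolution_le y i : inf_convolution y <= a i + c * enorm (y - p i).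
Proof. by apply: ge_inf => //; exists i. Qed.

Lemma le_inf_convolution (i0 : I) y r :
  (forall i, r <= a i + c * enorm (y - p i)) -> r <= inf_convolution y.
Proof.
move=> ry; apply: lb_le_inf; first by exists (a i0 + c * enorm (y - p i0)), i0.
by move=> _ [i _ <-].
Qed.

Lemma inf_convolution_lipschitz (i0 : I) : 0 <= c -> forall y z,
  inf_convolution y <= inf_convolution z + c * enorm (y - z).
Proof.
move=> c0 y z; rewrite -lerBlDr; apply: (le_inf_convolution i0) => i.
rewrite lerBlDr; apply: (le_trans (inf_convolution_le y i)).
rewrite -addrA lerD2l -mulrDr ler_wpM2l// [leRHS]addrC.
by have := enorm_triangle _ (y - z) (z - p i); rewrite subrKA.
Qed.

End inf_convolution.

Section lipschitz_test_functions.
Context {R : realType} {n : nat}.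
Local Open Scope ereal_scope.
Implicit Types (c : R) (h : 'cV[R]_n -> \bar R).

(** Values lie in the extended reals because Tonelli and the transition operator work there. The
    one-sided bound is two-sided by symmetry, and the range [0, 1] gives domination by the constant
    1. *)
Definition lip01 c h := (forall x, 0 <= h x <= 1) /\
  forall x y, h x <= h y + (c * enorm (x - y))%:E.

Lemma lip01_ge0 c h x : lip01 c h -> 0 <= h x.
Proof. by case=> /(_ x) /andP[]. Qed.

Lemma lip01_le1 c h x : lip01 c h -> h x <= 1.
Proof. by case=> /(_ x) /andP[]. Qed.

Lemma lip01_fin_num c h x : lip01 c h -> h x \is a fin_num.
Proof.
move=> hL; rewrite ge0_fin_numE ?(lip01_ge0 _ _ _ hL)//.
by rewrite (le_lt_trans (lip01_le1 _ _ x hL))// ltry.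
Qed.

Lemma lip01_measurable c h : lip01 c h -> measurable_fun setT h.
Proof.
move=> hL; rewrite (_ : h = EFin \o (fine \o h)); last first.
  by apply/funext => x /=; rewrite fineK// (lip01_fin_num _ _ _ hL).
apply/measurable_EFinP; apply: (enorm_lipschitz_measurable n (fine \o h) c) => x y /=.
rewrite -lee_fin EFinD !fineK ?(lip01_fin_num _ _ _ hL)//.
by case: hL => _; apply.
Qed.

Lemma probability_dominated_cvg d (T : measurableType d) (P : probability T R)
    (f : (T -> \bar R)^nat) (g : T -> \bar R) :
  (forall k, measurable_fun setT (f k)) -> measurable_fun setT g ->
  (forall k x, 0 <= f k x <= 1) -> {ae P, forall x, f ^~ x @ \oo --> g x} ->
  \int[P]_x f k x @[k --> \oo] --> \int[P]_x g x.
Proof.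
move=> mf mg f01 fg.
have [] := @dominated_convergence _ _ _ P setT measurableT f g (cst 1) mf mg => //.
- by apply: filterS fg => x ? _.
- exact: finite_measure_integrable_cst.
- by apply: aeW => x k _; have /andP[? ?] := f01 k x; rewrite gee0_abs.
Qed.

Lemma cvge_close (u v : (\bar R)^nat) (e : R^nat) (l : \bar R) :
  u @ \oo --> l -> e @ \oo --> 0%R ->
  (forall k, v k <= u k + (e k)%:E) -> (forall k, u k <= v k + (e k)%:E) ->
  v @ \oo --> l.
Proof.
move=> ul e0 vu uv.
have e0' : (e k)%:E @[k --> \oo] --> 0.
  by apply: cvg_EFin => //; exact: nearW.
have ne0 : (- e k)%:E @[k --> \oo] --> 0.
  by apply: cvg_EFin; [exact: nearW|rewrite -[X in _ --> X]oppr0; exact: (@cvgN _ R^o)].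
apply: (@squeeze_cvge _ _ _ _ (fun k => u k + (- e k)%:E) _ (fun k => u k + (e k)%:E)).
- by apply: nearW => k; rewrite vu andbT EFinN leeBlDr.
- by rewrite -[l]adde0; apply: cvgeD => //; rewrite fin_num_adde_defl.
- by rewrite -[l]adde0; apply: cvgeD => //; rewrite fin_num_adde_defl.
Qed.

(** Open sets form a pi-system generating the Borel sets, and the indicator of an open set is a
    pointwise limit of Lipschitz functions with values in [0, 1]. *)
Lemma lip01_determine (mu1 mu2 : probability 'cV[R]_n R) :
  (forall c h, (0 <= c)%R -> lip01 c h -> \int[mu1]_x h x = \int[mu2]_x h x) ->
  forall A, measurable A -> mu1 A = mu2 A.
Proof.
move=> mu12; apply: (@measure_unique _ _ _ (@open 'cV[R]_n) (fun=> setT)) => //.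
- by move=> A B; exact: openI.
- by move=> _; exact: openT.
- by rewrite bigcup_const.
- move=> U oU; have mU : measurable U by exact: sub_sigma_algebra.
  (* The [k]-Lipschitz regularisation of the indicator of U from below: every point of the space is
     a data point. *)
  pose h k y := (inf_convolution n (\1_U : _ -> R) id k%:R y)%:E.
  have lb k y : has_lbound
      (range (fun i => (\1_U : _ -> R) i + k%:R * enorm (y - id i))%R).
    exists 0%R => _ [i _ <-]; rewrite addr_ge0 ?mulr_ge0 ?enorm_ge0//.
  have hL k : lip01 k%:R (h k).
    split=> [x|x y]; last first.
      by rewrite -EFinD lee_fin; exact: (inf_convolution_lipschitz _ _ _ _ (lb k) x).
    rewrite !lee_fin; apply/andP; split.
      by apply: (le_inf_convolution _ _ _ _ x) => i; rewrite addr_ge0 ?mulr_ge0 ?enorm_ge0.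
    apply: (le_trans (inf_convolution_le _ _ _ _ (lb k) x x)).
    by rewrite subrr enorm0 mulr0 addr0 indicE lern1 leq_b1.
  have hU x : h ^~ x @ \oo --> (\1_U x)%:E.
    have [xU|xU] := boolP (x \in U); last first.
      rewrite (_ : h ^~ x = cst (\1_U x)%:E); first exact: cvg_cst.
      apply/funext => k; apply/eqP; rewrite eq_le /h lee_fin; apply/andP; split.
        apply: (le_trans (inf_convolution_le _ _ _ _ (lb k) x x)).
        by rewrite subrr enorm0 mulr0 addr0.
      by rewrite indicE (negbTE xU) (lip01_ge0 _ _ _ (hL k)).
    have /nbhs_ballP[e /= e0 eU] : nbhs x U.
      by apply: open_nbhs_nbhs; split => //; exact/set_mem.
    (* As soon as k e >= 1, every point outside U costs at least 1 by its distance to x, so the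
       infimum at x equals 1. *)
    apply: cvg_near_cst; exists (Num.truncn e^-1).+1 => // k /= ke.
    apply/eqP; rewrite eq_le indicE xU (lip01_le1 _ _ _ (hL k))/= lee_fin.
    apply: (le_inf_convolution _ _ _ _ x) => i; rewrite indicE.
    have [|iU] := boolP (i \in U); first by rewrite lerDl mulr_ge0 ?enorm_ge0.
    rewrite add0r; have ei : (e <= enorm (x - i))%R.
      rewrite leNgt; apply: contra iU => ie; apply/mem_set/eU; split => // j l.
      rewrite /ball/= (le_lt_trans _ ie)//.
      by have := ler_enorm _ _ (x - i) j l; rewrite !mxE.
    have ke' : (e^-1 <= k%:R)%R.
      by rewrite ltW// (lt_le_trans (truncnS_gt _))// ler_nat.
    have {}e0 : (0 < e)%R by [].
    apply: (@le_trans _ _ (e^-1 * e)%R); first by rewrite mulVf ?gt_eqF.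
    by apply: ler_pM => //; rewrite ?invr_ge0 ltW.
  have lim (mu : probability 'cV[R]_n R) : \int[mu]_x h k x @[k --> \oo] --> mu U.
    have -> : mu U = \int[mu]_x (\1_U x)%:E by rewrite integral_indic// setIT.
    apply: probability_dominated_cvg => //.
    + by move=> k; exact: lip01_measurable (hL k).
    + by apply/measurable_EFinP; exact: measurable_indic.
    + by move=> k x; case: (hL k).
    + exact: aeW.
  have := lim mu2; rewrite (_ : (fun k => _) = fun k => \int[mu1]_x h k x).
    by move=> l2; exact: (cvg_unique (@ereal_hausdorff R) (lim mu1) l2).
  by apply/funext => k; rewrite (mu12 k%:R).
- by move=> k; rewrite (@le_lt_trans _ _ 1) ?ltry// probability_le1.
Qed.

End lipschitz_test_functions.

(** * Iterated random functions that contract in mean *)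

Section iterated_random_functions.
Context {R : realType} {d dW} {Omega : measurableType d} (P : probability Omega R)
  {W : measurableType dW} {n : nat}.
Variables (xi : nat -> Omega -> W) (F : 'cV[R]_n * W -> 'cV[R]_n) (s : R).
Local Open Scope ereal_scope.
Local Notation E := 'cV[R]_n.

Let integral_prob_cst r : \int[P]_w r = r.
Proof. by rewrite integral_cst//= probability_setT mule1. Qed.

(** Only a generating family, not a sigma-algebra; the history of the noise before time [k] is
    [<<s past k >>]. *)
Definition past (k : nat) : set (set Omega) :=
  \bigcup_(j in [set j | (j < k)%N]) preimage_set_system setT (xi j) measurable.

Hypothesis mxi : forall k, measurable_fun setT (xi k).
Hypothesis mF : measurable_fun setT F.
Hypothesis xi_law : forall k D, measurable D ->
  P (xi k @^-1` D) = P (xi 0%N @^-1` D).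
Hypothesis xi_indep : forall k A D, <<s past k >> A -> measurable D ->
  P (A `&` xi k @^-1` D) = P A * P (xi k @^-1` D).
Hypothesis s01 : (0 <= s < 1)%R.
Hypothesis contraction : forall x y,
  \int[P]_w (enorm (F (x, xi 0%N w) - F (y, xi 0%N w)))%:E <= (s * enorm (x - y))%:E.
Hypothesis F0_integrable : \int[P]_w (enorm (F (0%R, xi 0%N w)))%:E < +oo.

Let s0 : (0 <= s)%R. Proof. by case/andP: s01. Qed.

(** The Markov operator of the chain acting on functions; its iterates on indicators are the k-step
    kernels. *)
Definition one_step (h : E -> \bar R) (x : E) := \int[P]_w h (F (x, xi 0%N w)).
Local Notation Q := one_step.

Lemma measurable_one_step h : measurable_fun setT h -> (forall x, 0 <= h x) ->
  measurable_fun setT (Q h).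
Proof.
move=> mh h0.
apply: (measurable_fun_fubini_tonelli_F (fun z => h (F (z.1, xi 0%N z.2)))) => //.
apply: (measurableT_comp mh); apply: (measurableT_comp mF).
apply: measurable_fun_pair => //; exact: (measurableT_comp (mxi 0%N)).
Qed.

Lemma one_step_ge0 h : (forall x, 0 <= h x) -> forall x, 0 <= Q h x.
Proof. by move=> h0 x; exact: integral_ge0. Qed.

Lemma iter_one_step_ge0 k h : (forall x, 0 <= h x) -> forall x, 0 <= iter k Q h x.
Proof. by elim: k h => //= k IH h h0; apply: one_step_ge0; exact: IH. Qed.

Lemma measurable_iter_one_step k h : measurable_fun setT h -> (forall x, 0 <= h x) ->
  measurable_fun setT (iter k Q h).
Proof.
move=> mh h0; elim: k => //= k IH; apply: measurable_one_step => //.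
exact: iter_one_step_ge0.
Qed.

Lemma integral_xi k (h : W -> \bar R) : measurable_fun setT h -> (forall x, 0 <= h x) ->
  \int[P]_w h (xi k w) = \int[P]_w h (xi 0%N w).
Proof.
move=> mh h0.
pose X (j : nat) : {mfun Omega >-> W} :=
  HB.pack (xi j) (isMeasurableFun.Build _ _ _ _ _ (mxi j)).
rewrite -(@ge0_integral_distribution _ _ _ _ _ P (X k))//.
rewrite -(@ge0_integral_distribution _ _ _ _ _ P (X 0%N))//.
by apply: eq_measure_integral => D mD _; exact: xi_law.
Qed.

Lemma past_measurable k : past k `<=` measurable.
Proof.
by move=> _ [j _ [D mD <-]]; apply: mxi.
Qed.

Lemma measurable_past_id k :
  measurable_fun setT (id : Omega -> g_sigma_algebraType (past k)).
Proof.
apply: (@measurability _ _ Omega (g_sigma_algebraType (past k)) setT id (past k)) => //.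
by move=> _ [A pA <-]; rewrite setTI; exact: past_measurable pA.
Qed.

Let measurable_past_fst k d' (T : measurableType d') :
  measurable_fun setT (fun z : Omega * T => (z.1 : g_sigma_algebraType (past k))).
Proof.
exact: (@measurableT_comp _ _ _ (Omega * T)%type Omega (g_sigma_algebraType (past k))
  id setT fst (measurable_past_id k) measurable_fst).
Qed.

Lemma measurable_past_xi j k : (j < k)%N ->
  measurable_fun setT (xi j : g_sigma_algebraType (past k) -> W).
Proof.
move=> jk _ D mD; apply: sub_sigma_algebra; exists j => //.
by exists D.
Qed.

(** Freezing the past: the history is encoded as the identity map from [Omega] into [Omega] with the
    coarser sigma-algebra. This identity is independent of [xi k], so Tonelli applies, and [xi k]
    may then be replaced by [xi 0], which has the same law. *)
Lemma integral_past k (H : g_sigma_algebraType (past k) * W -> \bar R) :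
  measurable_fun setT H -> (forall z, 0 <= H z) ->
  \int[P]_w H (w, xi k w) = \int[P]_w' \int[P]_w H (w, xi 0%N w').
Proof.
move=> mH H0.
have -> := @independent_tonelli _ _ _ Omega (g_sigma_algebraType (past k)) W R P
  id (xi k) (measurable_past_id k) (mxi k) _ H mH H0.
  rewrite (integral_xi k (fun v => \int[P]_w H (w, v)))//; last first.
    by move=> v; exact: integral_ge0.
  apply: (measurable_fun_fubini_tonelli_G (m1 := P) (fun z => H (id z.1, z.2))) => //.
  apply: (measurableT_comp mH
    (g := fun z : Omega * W => ((z.1 : g_sigma_algebraType (past k)), z.2))).
  by apply: measurable_fun_pair => //; exact: measurable_past_fst.
by move=> A B mA mB; exact: xi_indep.
Qed.

(* The maps are composed in the order opposite to that of the chain: the law of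
   the k-th term is the same, but the sequence converges almost surely. *)
Fixpoint backward (k : nat) (w : Omega) (x : E) : E :=
  if k is j.+1 then backward j w (F (x, xi j w)) else x.

Lemma measurable_past_backward j k : (j <= k)%N ->
  measurable_fun setT
    (fun z : g_sigma_algebraType (past k) * E => backward j z.1 z.2).
Proof.
elim: j => [|j IH] jk /=; first exact: measurable_snd.
apply: (measurableT_comp (IH (ltnW jk))
  (g := fun z : g_sigma_algebraType (past k) * E => (z.1, F (z.2, xi j z.1)))).
apply: measurable_fun_pair => //; apply: (measurableT_comp mF).
apply: measurable_fun_pair => //.
exact: (measurableT_comp (measurable_past_xi _ _ jk)).
Qed.

Lemma measurable_backward k x : measurable_fun setT (fun w => backward k w x).
Proof.
apply: (measurableT_comp (measurable_past_backward k k (leqnn k))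
  (g := fun w : Omega => ((w : g_sigma_algebraType (past k)), x))).
apply: measurable_fun_pair => //; exact: measurable_past_id.
Qed.

(** The newest noise acts innermost, on [x] itself. Freezing the other noises therefore peels off
    the outermost [Q] of the iterate. *)
Lemma integral_backward k h x : measurable_fun setT h -> (forall y, 0 <= h y) ->
  \int[P]_w h (backward k w x) = iter k Q h x.
Proof.
move=> mh h0; elim: k x => [|k IH] x.
  by rewrite /= integral_prob_cst.
rewrite (integral_past k (fun z => h (backward k z.1 (F (x, z.2)))))//.
  by rewrite iterS; apply: eq_integral => w _ /=; rewrite IH.
apply: (measurableT_comp mh).
apply: (measurableT_comp (measurable_past_backward k k (leqnn k))
  (g := fun z : g_sigma_algebraType (past k) * W => (z.1, F (x, z.2)))).
apply: measurable_fun_pair => //; apply: (measurableT_comp mF).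
exact: measurable_fun_pair.
Qed.

Let mF1 x : measurable_fun setT (fun w => F (x, xi 0%N w)).
Proof. by apply: (measurableT_comp mF); apply: measurable_fun_pair. Qed.

Lemma measurable_enormB d' (T : measurableType d') (f g : T -> E) :
  measurable_fun setT f -> measurable_fun setT g ->
  measurable_fun setT (fun w => (enorm (f w - g w))%:E).
Proof.
move=> mf mg; apply/measurable_EFinP; apply: (measurableT_comp (measurable_enorm n)).
apply: measurable_mx => i j; under eq_fun do rewrite !mxE.
by apply: measurable_funB; apply: (measurableT_comp (coord_measurable n 1 i j)).
Qed.

Let measurable_past_backward2 k (f g : W -> E) :
  measurable_fun setT f -> measurable_fun setT g ->
  measurable_fun setT (fun z : g_sigma_algebraType (past k) * W =>
    (enorm (backward k z.1 (f z.2) - backward k z.1 (g z.2)))%:E).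
Proof.
move=> mf mg; apply: measurable_enormB.
  apply: (measurableT_comp (measurable_past_backward k k (leqnn k))
    (g := fun z : g_sigma_algebraType (past k) * W => (z.1, f z.2))).
  by apply: measurable_fun_pair => //; exact: measurableT_comp.
apply: (measurableT_comp (measurable_past_backward k k (leqnn k))
  (g := fun z : g_sigma_algebraType (past k) * W => (z.1, g z.2))).
by apply: measurable_fun_pair => //; exact: measurableT_comp.
Qed.

(** The points [f (xi k w)] and [g (xi k w)] are independent of [backward k], so the bound for fixed
    points can be integrated over them. It is used with two images of [F] for the contraction, and
    with one image and the constant 0 for the successive differences. *)
Let integral_backward2 k (f g : W -> E) :
  measurable_fun setT f -> measurable_fun setT g ->
  (forall x y, \int[P]_w (enorm (backward k w x - backward k w y))%:E
     <= (s ^+ k * enorm (x - y))%:E) ->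
  \int[P]_w (enorm (backward k w (f (xi k w)) - backward k w (g (xi k w))))%:E <=
  (s ^+ k)%:E * \int[P]_w (enorm (f (xi 0%N w) - g (xi 0%N w)))%:E.
Proof.
move=> mf mg h.
rewrite (integral_past k
  (fun z => (enorm (backward k z.1 (f z.2) - backward k z.1 (g z.2)))%:E)); last 2 first.
- exact: measurable_past_backward2.
- by move=> z; rewrite lee_fin enorm_ge0.
have menorm : measurable_fun setT
    (fun w => (enorm (f (xi 0%N w) - g (xi 0%N w)))%:E).
  by apply: measurable_enormB; exact: measurableT_comp.
rewrite -ge0_integralZl//; last 2 first.
- by move=> w _; rewrite lee_fin enorm_ge0.
- by rewrite lee_fin exprn_ge0.
apply: ge0_le_integral => //.
- by move=> w _; apply: integral_ge0 => w' _; rewrite lee_fin enorm_ge0.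
- apply: (measurable_fun_fubini_tonelli_G (m1 := P) (fun z => (enorm
   (backward k z.1 (f (xi 0%N z.2)) - backward k z.1 (g (xi 0%N z.2))))%:E)).
    apply: (measurableT_comp (measurable_past_backward2 k _ _ mf mg)
      (g := fun z : Omega * Omega => ((z.1 : g_sigma_algebraType (past k)), xi 0%N z.2))).
    apply: measurable_fun_pair; first exact: measurable_past_fst.
    exact: measurableT_comp.
  by move=> z; rewrite lee_fin enorm_ge0.
- exact: measurable_funeM.
- move=> w _; have hw := h (f (xi 0%N w)) (g (xi 0%N w)).
  by rewrite EFinM in hw.
Qed.

Lemma backward_contraction k x y :
  \int[P]_w (enorm (backward k w x - backward k w y))%:E
  <= (s ^+ k * enorm (x - y))%:E.
Proof.
elim: k x y => [|k IH] x y.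
  by rewrite /= integral_prob_cst expr0 mul1r.
rewrite /=; apply: (le_trans
  (integral_backward2 k (fun v => F (x, v)) (fun v => F (y, v)) _ _ IH)).
- by apply: (measurableT_comp mF); exact: measurable_fun_pair.
- by apply: (measurableT_comp mF); exact: measurable_fun_pair.
- rewrite exprSr -mulrA EFinM lee_wpmul2l ?lee_fin ?exprn_ge0//.
Qed.

Lemma backward_step k :
  \int[P]_w (enorm (backward k.+1 w 0 - backward k w 0))%:E
  <= (s ^+ k)%:E * \int[P]_w (enorm (F (0%R, xi 0%N w)))%:E.
Proof.
rewrite /=; apply: (le_trans (integral_backward2 k (fun v => F (0%R, v)) (cst 0%R) _ _ _)).
- by apply: (measurableT_comp mF); exact: measurable_fun_pair.
- exact: measurable_cst.
- exact: backward_contraction.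
- by under eq_integral do rewrite subr0.
Qed.

Fixpoint forward (k : nat) (x : E) (w : Omega) : E :=
  if k is j.+1 then F (forward j x w, xi j w) else x.

Lemma measurable_past_forward j k x : (j <= k)%N ->
  measurable_fun setT (forward j x : g_sigma_algebraType (past k) -> E).
Proof.
elim: j => [|j IH] jk /=; first exact: measurable_cst.
apply: (measurableT_comp mF); apply: measurable_fun_pair; first exact: IH (ltnW jk).
exact: measurable_past_xi.
Qed.

Lemma measurable_forward k x : measurable_fun setT (forward k x).
Proof.
exact: (@measurableT_comp _ _ _ Omega (g_sigma_algebraType (past k)) E
  (forward k x) setT id (measurable_past_forward k k x (leqnn k)) (measurable_past_id k)).
Qed.

(** Here the newest noise acts outermost, so the innermost [Q] is peeled off, and Tonelli exchanges
    the past and the new noise. *)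
Lemma integral_forward k h x : measurable_fun setT h -> (forall y, 0 <= h y) ->
  \int[P]_w h (forward k x w) = iter k Q h x.
Proof.
elim: k h => [|k IH] h mh h0.
  by rewrite /= integral_prob_cst.
have mFk : measurable_fun setT
    (fun z : g_sigma_algebraType (past k) * W => F (forward k x z.1, z.2)).
  apply: (measurableT_comp mF); apply: measurable_fun_pair => //.
  exact: (measurableT_comp (measurable_past_forward k k x (leqnn k))).
rewrite iterSr -IH; [|exact: measurable_one_step|exact: one_step_ge0].
have -> := integral_past k (fun z => h (F (forward k x z.1, z.2)))
  (measurableT_comp mh mFk) (fun z => h0 _).
apply/esym/(fubini_tonelli (m1 := P) (m2 := P)
  (fun z => h (F (forward k x z.1, xi 0%N z.2)))) => //.
apply: (measurableT_comp mh); apply: (measurableT_comp mF).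
apply: measurable_fun_pair.
  exact: (measurableT_comp (measurable_forward k x)).
exact: measurableT_comp.
Qed.

(** Integrate the Lipschitz bound of [h] at the two images and apply the contraction in mean: each
    step shrinks the Lipschitz constant by [s]. *)
Lemma one_step_lip01 c h : (0 <= c)%R -> lip01 c h -> lip01 (s * c) (Q h).
Proof.
move=> c0 hL; have mh := lip01_measurable _ _ hL.
have mhF x : measurable_fun setT (fun w => h (F (x, xi 0%N w))) by exact: measurableT_comp.
have h0 x := lip01_ge0 _ _ x hL.
split=> [x|x y].
  rewrite one_step_ge0//=.
  rewrite -(integral_prob_cst 1).
  by apply: ge0_le_integral => // w _; exact: lip01_le1 hL.
have mxy : measurable_fun setT
    (fun w => (enorm (F (x, xi 0%N w) - F (y, xi 0%N w)))%:E).
  exact: measurable_enormB.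
have e0 w : 0 <= (enorm (F (x, xi 0%N w) - F (y, xi 0%N w)))%:E.
  by rewrite lee_fin enorm_ge0.
apply: (@le_trans _ _ (Q h y + c%:E *
    \int[P]_w (enorm (F (x, xi 0%N w) - F (y, xi 0%N w)))%:E)); last first.
  by rewrite leeD2l// mulrAC mulrC EFinM lee_wpmul2l.
rewrite -ge0_integralZl// -ge0_integralD//; last 2 first.
- by move=> w _; exact: mule_ge0.
- exact: measurable_funeM.
apply: ge0_le_integral => //.
- by apply: emeasurable_funD => //; exact: measurable_funeM.
- by move=> w _; case: hL => _; apply.
Qed.

Lemma iter_one_step_lip01 k c h : (0 <= c)%R -> lip01 c h ->
  lip01 (s ^+ k * c) (iter k Q h).
Proof.
move=> c0 hL; elim: k => [|k IH] /=; first by rewrite expr0 mul1r.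
by rewrite exprS -mulrA; apply: one_step_lip01 => //; rewrite mulr_ge0// exprn_ge0.
Qed.

(** An upper limit made real by [fine] is defined and measurable for every [w], with no null set to
    remove; it is the true limit wherever the iterates converge. *)
Definition backward_limit (w : Omega) : E :=
  \col_i fine (limn_esup (fun k => (backward k w 0%R i 0%R)%:E)).

Lemma measurable_backward_limit : measurable_fun setT backward_limit.
Proof.
apply: measurable_mx => i j; under eq_fun do rewrite mxE.
apply: measurableT_comp => //.
apply: (measurable_fun_limn_esup (f := fun k w => (backward k w 0%R i 0%R)%:E)) => k.
apply/measurable_EFinP.
exact: (measurableT_comp (coord_measurable n 1 i 0%R) (measurable_backward k 0%R)).
Qed.

(** The expected step lengths are bounded by a convergent geometric series, so the sum of all step
    lengths has finite expectation and is finite almost surely. *)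
Lemma backward_cvg : {ae P, forall w, forall i,
  (backward k w 0%R i 0%R)%:E @[k --> \oo] --> (backward_limit w i 0%R)%:E}.
Proof.
pose D k w := enorm (backward k.+1 w 0%R - backward k w 0%R).
have D0 k w : 0 <= (D k w)%:E by rewrite lee_fin enorm_ge0.
have mD k : measurable_fun setT (fun w => (D k w)%:E).
  by apply: measurable_enormB; exact: measurable_backward.
pose C := fine (\int[P]_w (enorm (F (0%R, xi 0%N w)))%:E).
have CE : \int[P]_w (enorm (F (0%R, xi 0%N w)))%:E = C%:E.
  rewrite fineK// ge0_fin_numE//; apply: integral_ge0 => w _.
  by rewrite lee_fin enorm_ge0.
have sumD : \int[P]_w (\sum_(k <oo) (D k w)%:E) < +oo.
  rewrite integral_nneseries//.
  have cvgS : (\sum_(0 <= k < m) (C * s ^+ k)%:E) @[m --> \oo] --> (C / (1 - s))%:E.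
    under eq_fun do rewrite sumEFin.
    apply: (cvg_EFin _ _).
      by near=> m.
    apply: cvg_geometric_series.
    by case/andP: s01 => ? ?; rewrite ger0_norm.
  apply: (@le_lt_trans _ _ (\sum_(k <oo) (C * s ^+ k)%:E)).
    apply: lee_nneseries => [k _ _|k _]; first exact: integral_ge0.
    by rewrite mulrC EFinM -CE; exact: backward_step.
  by rewrite (cvg_lim _ cvgS)// ltry.
have Sfin : P.-integrable setT (fun w => \sum_(k <oo) (D k w)%:E).
  apply/integrableP; split; first exact: ge0_emeasurable_sum.
  by under eq_integral do rewrite gee0_abs ?nneseries_ge0//.
apply: filterS (integrable_ae measurableT Sfin) => w /(_ I) Sw i.
have cv : cvgn (fun k => backward k w 0%R i 0%R).
  (* Each coordinate starts from 0 and is the telescoping series of its increments, which are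
     bounded in absolute value by the step lengths [D k w]. *)
  pose u k := (backward k.+1 w 0%R i 0%R - backward k w 0%R i 0%R)%R.
  have -> : (fun k => backward k w 0%R i 0%R) = series u.
    apply/funext => k; rewrite /series/= telescope_sumr//=.
    by rewrite mxE subr0.
  apply: normed_cvg.
  apply: (@nondecreasing_is_cvgn _ _) => //.
    apply: nondecreasing_series => k _ _; exact: normr_ge0.
  exists (fine (\sum_(k <oo) (D k w)%:E)) => _ [m _ <-].
  rewrite -lee_fin fineK//=; apply: (@le_trans _ _ (\sum_(0 <= k < m) (D k w)%:E)).
    rewrite sumEFin lee_fin ler_sum// => k _.
    have := ler_enorm _ _ (backward k.+1 w 0%R - backward k w 0%R) i 0%R.
    by rewrite /u /D !mxE.
  by apply: nneseries_lim_ge => k _.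
have cvE : (backward k w 0%R i 0%R)%:E @[k --> \oo] -->
    (limn (fun k => backward k w 0%R i 0%R))%:E.
  by apply: cvg_EFin; [exact: nearW|exact: cv].
rewrite /backward_limit mxE.
have /cvg_limn_einf_sup [_ ->] := cvE.
done.
Unshelve. all: by end_near. Qed.

Lemma integral_backward_cvg c h : (0 <= c)%R -> lip01 c h ->
  iter k Q h 0%R @[k --> \oo] --> \int[P]_w h (backward_limit w).
Proof.
move=> c0 hL; have mh := lip01_measurable _ _ hL.
have -> : (fun k => iter k Q h 0%R) = (fun k => \int[P]_w h (backward k w 0%R)).
  by apply/funext => k; rewrite integral_backward// => y; exact: lip01_ge0 hL.
apply: probability_dominated_cvg.
- by move=> k; apply: (measurableT_comp mh); exact: measurable_backward.
- by apply: (measurableT_comp mh); exact: measurable_backward_limit.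
- by move=> k x; case: hL.
apply: filterS backward_cvg => w wcv.
apply: (cvge_close (cst (h (backward_limit w))) _ (fun k => c *
  \sum_(i < n) `|backward k w 0%R i 0%R - backward_limit w i 0%R|)%R).
- exact: cvg_cst.
- rewrite -[X in _ --> X](mulr0 c); apply: cvgMr => //.
  rewrite [X in _ --> X](_ : _ = \sum_(i < n) 0)%R; last by rewrite big1.
  apply: cvg_big; first exact: add_continuous.
  move=> i _; rewrite -[X in _ --> X](@normr0 _ R^o).
  apply: cvg_norm; rewrite -[X in _ --> X](subrr (backward_limit w i 0%R)).
  by apply: cvgB; [exact: fine_cvg (wcv i)|exact: cvg_cst].
- move=> k; case: hL => _ /(_ (backward k w 0%R) (backward_limit w)) hk.
  apply: (le_trans hk); rewrite leeD2l// lee_fin ler_wpM2l//.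
  by apply: (le_trans (enorm_le_sum _ _)); apply: ler_sum => i _; rewrite !mxE.
- move=> k; case: hL => _ /(_ (backward_limit w) (backward k w 0%R)) hk.
  apply: (le_trans hk); rewrite leeD2l// lee_fin ler_wpM2l// enormB.
  by apply: (le_trans (enorm_le_sum _ _)); apply: ler_sum => i _; rewrite !mxE.
Qed.

(** The Lipschitz constant of [iter k Q h] is s^k c, so the values at [x] and at 0 become
    indistinguishable. *)
Lemma iter_one_step_cvg c h x : (0 <= c)%R -> lip01 c h ->
  iter k Q h x @[k --> \oo] --> \int[P]_w h (backward_limit w).
Proof.
move=> c0 hL; apply: (cvge_close _ _ (fun k => s ^+ k * c * enorm x)%R).
- exact: integral_backward_cvg c0 hL.
- rewrite -(mul0r (enorm x)) -(mul0r c); apply: cvgMl; apply: cvgMl.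
  by apply: cvg_expr; case/andP: s01 => ? ?; rewrite ger0_norm.
- move=> k; have [_ /(_ x 0%R)] := iter_one_step_lip01 k _ _ c0 hL.
  by rewrite subr0.
- move=> k; have [_ /(_ 0%R x)] := iter_one_step_lip01 k _ _ c0 hL.
  by rewrite sub0r enormN.
Qed.

(** The image of [Pi] under one step of the chain, realised as the law of F(x, xi_0) under the
    product of [Pi] and [P]. Having it as a measure lets identities pass between sets and
    functions. *)
Lemma one_step_law (Pi : probability E R) : exists Pi1 : probability E R,
  forall h, measurable_fun setT h -> (forall x, 0 <= h x) ->
  \int[Pi1]_x h x = \int[Pi]_x Q h x.
Proof.
have mFxi : measurable_fun setT (fun z : E * Omega => F (z.1, xi 0%N z.2)).
  by apply: (measurableT_comp mF); apply: measurable_fun_pair => //; exact: measurableT_comp.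
pose G : {mfun (E * Omega)%type >-> E} :=
  HB.pack (fun z : E * Omega => F (z.1, xi 0%N z.2)) (isMeasurableFun.Build _ _ _ _ _ mFxi).
exists (distribution (Pi \x P)%E G) => h mh h0.
rewrite (@ge0_integral_distribution _ _ _ _ _ (Pi \x P)%E G)//.
by rewrite (fubini_tonelli1 (fun z => h (F (z.1, xi 0%N z.2))))//; exact: measurableT_comp.
Qed.

Let integral_indicT (mu : probability E R) A : measurable A ->
  \int[mu]_x (EFin \o \1_A) x = mu A.
Proof. by move=> mA; rewrite integral_indic// setIT. Qed.

Let measurable_EFin_indic (A : set E) : measurable A ->
  measurable_fun setT (EFin \o (\1_A : E -> R)).
Proof. by move=> mA; apply/measurable_EFinP; exact: measurable_indic. Qed.

Let EFin_indic_ge0 (A : set E) x : 0 <= (EFin \o (\1_A : E -> R)) x.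
Proof. by rewrite lee_fin. Qed.

Lemma stationary_integral (Pi : probability E R) :
  (forall A, measurable A -> Pi A = \int[Pi]_x Q (EFin \o \1_A) x) ->
  forall h, measurable_fun setT h -> (forall x, 0 <= h x) ->
  \int[Pi]_x Q h x = \int[Pi]_x h x.
Proof.
move=> PiQ h mh h0; have [Pi1 Pi1E] := one_step_law Pi.
rewrite -Pi1E//; apply: eq_measure_integral => A mA _.
transitivity (\int[Pi1]_x (EFin \o \1_A) x); first by rewrite integral_indicT.
by rewrite Pi1E//; [exact/esym/PiQ|exact: (measurable_EFin_indic _ mA)].
Qed.

Lemma stationary_iter (Pi : probability E R) :
  (forall A, measurable A -> Pi A = \int[Pi]_x Q (EFin \o \1_A) x) ->
  forall k h, measurable_fun setT h -> (forall x, 0 <= h x) ->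
  \int[Pi]_x iter k Q h x = \int[Pi]_x h x.
Proof.
move=> PiQ k h mh h0; elim: k => //= k <-; apply: stationary_integral => //.
  exact: measurable_iter_one_step.
exact: iter_one_step_ge0.
Qed.

Theorem unique_stationary : exists Pi : probability E R,
  (forall k A, measurable A -> Pi A = \int[Pi]_x iter k Q (EFin \o \1_A) x) /\
  forall Pi' : probability E R,
    (forall A, measurable A -> Pi' A = \int[Pi']_x Q (EFin \o \1_A) x) ->
    forall A, measurable A -> Pi' A = Pi A.
Proof.
pose Z : {mfun Omega >-> E} := HB.pack backward_limit
  (isMeasurableFun.Build _ _ _ _ _ measurable_backward_limit).
pose Pi : probability E R := distribution P Z.
have PiE h : measurable_fun setT h -> (forall x, 0 <= h x) ->
    \int[Pi]_x h x = \int[P]_w h (backward_limit w).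
  by move=> mh h0; rewrite (@ge0_integral_distribution _ _ _ _ _ P Z).
have PiQ A : measurable A -> Pi A = \int[Pi]_x Q (EFin \o \1_A) x.
  move=> mA; have [Pi1 Pi1E] := one_step_law Pi.
  rewrite -Pi1E//; last exact: (measurable_EFin_indic _ mA).
  rewrite integral_indicT//; apply: lip01_determine => // c h c0 hL.
  have mh := lip01_measurable _ _ hL; have h0 x := lip01_ge0 _ _ x hL.
  have sc0 : (0 <= s * c)%R by exact: mulr_ge0.
  have QL := one_step_lip01 _ _ c0 hL.
  rewrite Pi1E// !PiE//; [|exact: measurable_one_step|exact: one_step_ge0].
  (* The same sequence is read in two ways: as [iter k Q] applied to [Q h], and as the shifted
     iterates of [h]. Equality of the two limits is invariance tested on [h]. *)
  have l1 : iter k.+1 Q h 0%R @[k --> \oo] --> \int[P]_w Q h (backward_limit w).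
    have := iter_one_step_cvg _ _ 0%R sc0 QL.
    by under eq_fun do rewrite -iterSr.
  have l2 : iter k.+1 Q h 0%R @[k --> \oo] --> \int[P]_w h (backward_limit w).
    have := iter_one_step_cvg _ _ 0%R c0 hL.
    by rewrite -cvg_shiftS.
  exact: (cvg_unique (@ereal_hausdorff R) l2 l1).
exists Pi; split=> [k A mA|Pi' Pi'Q A mA].
  rewrite stationary_iter ?integral_indicT//; exact: (measurable_EFin_indic _ mA).
apply: lip01_determine => // c h c0 hL.
have mh := lip01_measurable _ _ hL; have h0 x := lip01_ge0 _ _ x hL.
(* For a stationary [Pi'] these integrals do not depend on [k], while the integrands converge to a
   constant; so that constant is the integral of [h]. *)
have l1 : \int[Pi']_x iter k Q h x @[k --> \oo] -->
    \int[Pi']_x (cst (\int[P]_w h (backward_limit w)) x).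
  apply: probability_dominated_cvg.
  - by move=> k; exact: measurable_iter_one_step.
  - exact: measurable_cst.
  - by move=> k x; have [] := iter_one_step_lip01 k _ _ c0 hL.
  - by apply: aeW => x; exact: iter_one_step_cvg c0 hL.
rewrite PiE//; move: l1; rewrite integral_cst//= probability_setT mule1.
under eq_fun do rewrite stationary_iter//.
by move=> l1; exact: (cvg_unique (@ereal_hausdorff R) (cvg_cst _) l1).
Qed.

End iterated_random_functions.

(** * Gaussian vectors *)

Section normal_second_moment.
Context {R : realType} (sigma : R).
Hypothesis sigma0 : sigma != 0.
Local Notation p := (normal_pdf 0 sigma).
Local Notation mu := (@lebesgue_measure R).

Lemma is_derive_normal_pdf (x : R) : is_derive x (1 : R) p (- (x / sigma ^+ 2) * p x).
Proof.
rewrite normal_pdfE// /normal_fun.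
apply: (@is_derive_eq _ _ _ _ _ _ _).
by rewrite /GRing.scale/= subr0 !(mulr0, addr0, add0r, mulr1); field.
Qed.

(** A primitive of [f], since sigma^2 p' = - x p; this is integration by parts for the second
    moment. *)
Let F (x : R) : R := - (sigma ^+ 2 * (x * p x)).
Let f (x : R) : R := x ^+ 2 * p x - sigma ^+ 2 * p x.

Let is_derive_F (x : R) : is_derive x (1 : R) F (f x).
Proof.
have := is_derive_normal_pdf x => dp.
apply: (@is_derive_eq _ _ _ _ _ _ _); rewrite /f /GRing.scale/= mulr1.
by field.
Qed.

Let continuous_p : continuous p. Proof. exact: continuous_normal_pdf. Qed.

Let continuous_x2p : continuous (fun x : R => x ^+ 2 * p x).
Proof. by move=> x; apply: cvgM; [exact: exprn_continuous|exact: continuous_p]. Qed.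

Let continuous_f : continuous f.
Proof.
move=> x; apply: (@cvgB _ R^o); first exact: continuous_x2p.
by apply: cvgM; [exact: cvg_cst|exact: continuous_p].
Qed.

Let integrable_itv (h : R -> R) (a : R) : continuous h ->
  mu.-integrable `[- a, a] (EFin \o h).
Proof.
move=> ch; apply: continuous_compact_integrable; first exact: segment_compact.
exact: continuous_subspaceT.
Qed.

(** The boundary terms F(a) - F(-a) are nonpositive. As only an upper bound on the variance is
    wanted, their limit need not be computed. *)
Let integral_f_le0 (a : R) : 0 < a -> (\int[mu]_(x in `[(- a)%R, a]) (f x)%:E <= 0)%E.
Proof.
move=> a0; rewrite (@continuous_FTC2 _ f F (- a) a).
- rewrite -EFinB lee_fin /F mulNr !mulrN opprK -opprD oppr_le0.
  by apply: addr_ge0; apply: mulr_ge0; rewrite ?sqr_ge0 // mulr_ge0 ?normal_pdf_ge0 // ltW.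
- by rewrite gtrN.
- exact: continuous_subspaceT.
- have cF : continuous F.
    move=> x; apply: differentiable_continuous; apply/derivable1_diffP.
    by case: (is_derive_F x).
  split.
  + by move=> x _; case: (is_derive_F x).
  + by apply: cvg_at_right_filter; exact: cF.
  + by apply: cvg_at_left_filter; exact: cF.
- by move=> x _; rewrite derive1E; case: (is_derive_F x).
Qed.

Let integral_itv_le (a : R) : 0 < a ->
  (\int[mu]_(x in `[(- a)%R, a]) (x ^+ 2 * p x)%:E <= (sigma ^+ 2)%:E)%E.
Proof.
move=> a0.
have -> : (\int[mu]_(x in `[(- a)%R, a]) (x ^+ 2 * p x)%:E =
   \int[mu]_(x in `[(- a)%R, a]) (f x)%:E +
   \int[mu]_(x in `[(- a)%R, a]) ((sigma ^+ 2)%:E * (p x)%:E))%E.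
  rewrite -integralD//; last 2 first.
  - exact: integrable_itv.
  - by apply: integrableZl => //; exact: (integrable_itv p).
  by apply: eq_integral => x _; rewrite -EFinM -EFinD /f subrK.
rewrite -[leRHS]add0e; apply: leeD; first exact: integral_f_le0.
rewrite integralZl//; last exact: (integrable_itv p).
rewrite -[leRHS]mule1; apply: lee_wpmul2l; first by rewrite lee_fin sqr_ge0.
rewrite -(integral_normal_pdf 0 sigma); apply: ge0_subset_integral => //.
- by apply/measurable_EFinP; exact: measurable_normal_pdf.
- by move=> x _; rewrite lee_fin normal_pdf_ge0.
Qed.

(** The Radon-Nikodym derivative of [normal_prob] agrees almost everywhere with the density [p],
    because both have the same integrals over measurable subsets of [D]. *)
Lemma normal_prob_density (h : R -> R) (D : set R) :
  measurable D -> measurable_fun D h -> (normal_prob 0 sigma).-integrable D (EFin \o h) ->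
  (\int[normal_prob 0 sigma]_(x in D) (h x)%:E = \int[mu]_(x in D) (h x * p x)%:E)%E.
Proof.
move=> mD mh ih; have dom := normal_prob_dominates (0 : R) sigma.
rewrite -(Radon_Nikodym_change_of_variables dom mD ih).
have mhE : measurable_fun D (EFin \o h) by exact/measurable_EFinP.
have mp : measurable_fun D (EFin \o p).
  by apply/measurable_funTS/measurable_EFinP; exact: measurable_normal_pdf.
under [RHS]eq_integral do rewrite EFinM.
apply: ae_eq_integral => //.
- apply: emeasurable_funM => //; apply: (measurable_int mu).
  apply: (integrableS _ _ (@subsetT _ _)) => //=.
  exact: Radon_Nikodym_integrable.
- exact: emeasurable_funM.
- apply: ae_eqe_mul2l => /=; rewrite Radon_NikodymE//=.
  case: cid => /= k [k1 k2 k3]; apply: integral_ae_eq => //=.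
  + exact: integrableS k2.
  + by move=> A AD mA; rewrite -k3.
Qed.

Lemma normal_second_moment :
  (\int[normal_prob 0 sigma]_x (x ^+ 2)%:E <= (sigma ^+ 2)%:E)%E.
Proof.
(* The radius k+1 is positive, as the bound on symmetric intervals requires, and on [I k] the square
   is bounded, hence integrable. *)
pose I (k : nat) : set R := `[- k.+1%:R, k.+1%:R]%classic.
pose h k (x : R) := ((x ^+ 2)%:E * (\1_(I k) x)%:E)%E.
have mI k : measurable (I k) by exact: measurable_itv.
have mx2 : measurable_fun setT (fun x : R => (x ^+ 2)%:E).
  by apply/measurable_EFinP; exact: exprn_measurable.
have mh k : measurable_fun setT (h k).
  by apply: emeasurable_funM => //; apply/measurable_EFinP; exact: measurable_indic.
have h0 k x : (0 <= h k x)%E by rewrite mule_ge0 ?lee_fin ?sqr_ge0.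
have ndh x : {homo h ^~ x : k l / (k <= l)%N >-> (k <= l)%E}.
  move=> k l kl; apply: lee_wpmul2l; rewrite lee_fin ?sqr_ge0//.
  rewrite !indicE ler_nat; case: (boolP (x \in I k)) => // /set_mem xk.
  rewrite mem_set//; move: xk; rewrite /I /= !in_itv/= => /andP[xk1 xk2].
  have kl' : k.+1%:R <= l.+1%:R :> R by rewrite ler_nat.
  by rewrite (le_trans _ xk1) ?lerN2//= (le_trans xk2).
have hx x : limn (h ^~ x) = (x ^+ 2)%:E.
  apply/cvg_lim => //; apply: cvg_near_cst.
  exists (Num.truncn `|x|) => // k /= kx; rewrite /h indicE mem_set ?mule1//.
  rewrite /I/= in_itv/= -ler_norml ltW// (lt_le_trans (truncnS_gt _))//.
  by rewrite ler_nat ltnS.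
under eq_integral do rewrite -hx.
rewrite monotone_convergence//.
apply: lime_le.
  apply: ereal_nondecreasing_is_cvgn => k l kl; apply: ge0_le_integral => //.
  1,2: exact: mh.
  by move=> x _; apply: ndh.
apply: nearW => k; have k0 : 0 < k.+1%:R :> R by [].
apply: le_trans (integral_itv_le _ k0).
rewrite [leLHS](_ : _ = \int[normal_prob 0 sigma]_(x in I k) (x ^+ 2)%:E)%E.
  rewrite (normal_prob_density (fun x => x ^+ 2))//.
  apply: measurable_bounded_integrable => //.
  - exact: mI.
  - exact: le_lt_trans (probability_le1 (normal_prob 0 sigma) (mI k)) (ltry _).
  exists (k.+1%:R ^+ 2); split; first exact: num_real.
  move=> M kM x /= xk; rewrite ger0_norm ?sqr_ge0// (le_trans _ (ltW kM))//.
  rewrite -real_normK ?num_real// lerXn2r ?nnegrE//.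
  by move: xk; rewrite /I/= in_itv/= -ler_norml.
rewrite [RHS]integral_mkcond; apply: eq_integral => x _.
by rewrite /h indicE patchE; case: ifPn => _; rewrite ?mule1 ?mule0.
Qed.

End normal_second_moment.

(** It suffices to compare half-lines, where the substitution z |-> - z and the evenness of the
    density conclude. *)
Lemma normal_prob_opp {R : realType} (sigma : R) (A : set R) : sigma != 0 -> measurable A ->
  normal_prob 0 sigma (-%R @^-1` A) = normal_prob 0 sigma A.
Proof.
move=> s0 mA.
have mN : measurable_fun setT (-%R : R -> R) by exact: oppr_measurable.
pose opp : {mfun measurableTypeR R >-> measurableTypeR R} :=
  HB.pack (-%R : R -> R)
  (isMeasurableFun.Build _ _ (measurableTypeR R) (measurableTypeR R) _ mN).
change (distribution (normal_prob 0 sigma) opp A = normal_prob 0 sigma A).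
refine (@measure_unique _ R (measurableTypeR R) (@RGenCInfty.G R)
  (fun k => `[- k%:R, +oo[%classic) _ _ _ _
  (distribution (normal_prob 0 sigma) opp) (normal_prob 0 sigma) _ _ A mA) => //.
- exact: RGenCInfty.measurableE.
- move=> _ _ [x ->] [y ->]; exists (Num.max x y); apply/seteqP; split=> z /=.
    by rewrite !in_itv/= !andbT ge_max => -[-> ->].
  by rewrite !in_itv/= !andbT ge_max => /andP[-> ->].
- by move=> k; exists (- k%:R).
- apply/seteqP; split=> // x _; exists (Num.truncn `|x|).+1 => //=.
  rewrite in_itv/= andbT lerNl (le_trans (ler_norm _))// normrN ltW//.
  exact: truncnS_gt.
- move=> _ [x ->]; rewrite /= /distribution/= /pushforward/= /normal_prob.
  rewrite (_ : _ @^-1` _ = `]-oo, - x]%classic); last first.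
    by apply/seteqP; split=> z /=; rewrite !in_itv/= andbT lerNr.
  rewrite ge0_integration_by_substitutionNy.
  + by apply: eq_integral => z _; rewrite /= !normal_pdfE// /normal_fun !subr0 sqrrN.
  + by apply: continuous_subspaceT; exact: continuous_normal_pdf.
  + by move=> z _; exact: normal_pdf_ge0.
- move=> k; apply: le_lt_trans (ltry _).
  exact: (probability_le1 (distribution (normal_prob 0 sigma) opp)).
Qed.

(** Boxes form a pi-system, and they generate the Borel sets because the identity is measurable
    coordinate by coordinate. *)
Lemma box_law_unique {R : realType} (n : nat) (mu1 mu2 : probability 'cV[R]_n R) :
  (forall A : 'I_n -> set R, (forall j, measurable (A j)) ->
    mu1 [set x | forall j, A j (x j 0)] = mu2 [set x | forall j, A j (x j 0)]) ->
  forall D, measurable D -> mu1 D = mu2 D.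
Proof.
move=> mu12 D mD.
pose G : set (set 'cV[R]_n) := [set B | exists2 A : 'I_n -> set R,
  forall j, measurable (A j) & B = [set x : 'cV[R]_n | forall j, A j (x j 0)]].
have Gm : G `<=` measurable.
  move=> _ [A mA ->]; rewrite [X in measurable X](_ : _ =
      \big[setI/setT]_(j < n) ((fun x : 'cV[R]_n => x j 0) @^-1` A j)).
    apply: bigsetI_measurable => j _; rewrite -[X in measurable X]setTI.
    exact: coord_measurable.
  apply/seteqP; split=> x; rewrite -bigcap_seq => /= Ax j; first by move=> _; exact: Ax.
  exact: (Ax j (mem_index_enum j)).
have GT : G setT.
  by exists (fun=> setT) => //; apply/seteqP; split.
have sGD : <<s G >> D.
  have mid : measurable_fun setT (id : g_sigma_algebraType G -> 'cV[R]_n).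
    apply: measurable_mx => i j _ A mA; rewrite setTI; apply: sub_sigma_algebra.
    exists (fun k => if k == i then A else setT).
      by move=> k; case: ifP.
    rewrite (ord1 j); apply/seteqP; split=> x /=.
      by move=> Ax k; case: eqP => // ->.
    by move=> /(_ i); rewrite eqxx.
  by have := mid measurableT _ mD; rewrite setTI.
apply: (@g_sigma_algebra_measure_unique _ _ _ G Gm (fun=> setT) _ _ mu1 mu2) => //.
- by rewrite bigcup_const.
- move=> _ _ [A mA ->] [B mB ->]; exists (fun j => A j `&` B j).
    by move=> j; exact: measurableI.
  apply/seteqP; split=> x /=; first by move=> [Ax Bx] j.
  by move=> ABx; split=> j; have [] := ABx j.
- by move=> _ [A mA ->]; exact: mu12.
- by move=> _; rewrite (le_lt_trans (probability_le1 _ _)) ?ltry.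
Qed.

(** * Second moments of affine images of a Gaussian vector *)

Section gaussian_vector.
Context {R : realType} {d} {Omega : measurableType d} (P : probability Omega R).
Context {m : nat} (N : Omega -> 'cV[R]_m) (sigma : R).
Hypothesis sigma0 : sigma != 0.
Hypothesis mN : measurable_fun setT N.
Hypothesis N_law : forall A : 'I_m -> set R, (forall j, measurable (A j)) ->
  P [set w | forall j, A j (N w j 0)] = (\prod_(j < m) normal_prob 0 sigma (A j))%E.

Lemma gaussian_coord_law j A : measurable A ->
  P ((fun w => N w j 0) @^-1` A) = normal_prob 0 sigma A.
Proof.
move=> mA; have := N_law (fun k => if k == j then A else setT).
rewrite (bigD1 j)//= eqxx big1 ?mule1; last first.
  by move=> k /negPf ->; exact: probability_setT.
move=> <-; last by move=> k; case: ifP.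
congr (P _); apply/seteqP; split=> w /=.
  by move=> Aw k; case: eqP => // ->.
by move=> /(_ j); rewrite eqxx.
Qed.

Lemma gaussian_second_moment j :
  (\int[P]_w ((N w j 0) ^+ 2)%:E <= (sigma ^+ 2)%:E)%E.
Proof.
have mNj : measurable_fun setT (fun w => N w j 0).
  exact: (measurableT_comp (coord_measurable m 1 j 0) mN).
pose Nj : {mfun Omega >-> measurableTypeR R} :=
  HB.pack (fun w => N w j 0) (isMeasurableFun.Build _ _ _ (measurableTypeR R) _ mNj).
apply: le_trans (normal_second_moment _ sigma0).
rewrite -(@ge0_integral_distribution _ _ _ _ _ P Nj (fun x => (x ^+ 2)%:E)).
- rewrite le_eqVlt; apply/orP; left; apply/eqP.
  by apply: eq_measure_integral => A mA _; exact: gaussian_coord_law.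
- by apply/measurable_EFinP; exact: exprn_measurable.
- by move=> x; rewrite lee_fin sqr_ge0.
Qed.

Definition flip (j : 'I_m) (x : 'cV[R]_m) : 'cV[R]_m :=
  \col_k (if k == j then - x k 0 else x k 0).

Lemma measurable_flip j : measurable_fun setT (flip j).
Proof.
apply: measurable_mx => k l; under eq_fun do rewrite mxE.
case: eqP => _; last exact: coord_measurable.
by apply: measurableT_comp => //; exact: coord_measurable.
Qed.

Lemma gaussian_flip j (h : 'cV[R]_m -> \bar R) : measurable_fun setT h ->
  (forall x, 0 <= h x)%E -> (\int[P]_w h (flip j (N w)) = \int[P]_w h (N w))%E.
Proof.
move=> mh h0.
pose X : {mfun Omega >-> 'cV[R]_m} := HB.pack N (isMeasurableFun.Build _ _ _ _ _ mN).
have mfN : measurable_fun setT (flip j \o N).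
  by apply: measurableT_comp => //; exact: measurable_flip.
pose Y : {mfun Omega >-> 'cV[R]_m} :=
  HB.pack (flip j \o N) (isMeasurableFun.Build _ _ _ _ _ mfN).
rewrite -(@ge0_integral_distribution _ _ _ _ _ P X)//.
rewrite -(@ge0_integral_distribution _ _ _ _ _ P Y)//.
apply: eq_measure_integral => D mD _; apply: box_law_unique => // A mA.
rewrite /distribution/= /pushforward/=.
transitivity (P [set w | forall k, (if k == j then -%R @^-1` A k else A k) (N w k 0)]).
  congr (P _); apply/seteqP; split=> w /= Aw k; have := Aw k; rewrite mxE;
  by case: eqP.
rewrite (N_law (fun k => if k == j then -%R @^-1` A k else A k)); last first.
  move=> k; case: ifP => // _; rewrite -[X in measurable X]setTI.
  exact: oppr_measurable.
rewrite -[RHS]/(P [set w | forall k, A k (N w k 0)]) N_law//.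
by apply: eq_bigr => k _; case: ifP => // _; exact: normal_prob_opp.
Qed.

(** The affine image v + g x restricted to the coordinates listed in [s], so that induction on the
    list adds one coordinate at a time. *)
Let lin (n : nat) (v : 'cV[R]_n) (g : 'M[R]_(n, m)) (s : seq 'I_m) (x : 'cV[R]_m) :=
  v + \sum_(j <- s) x j 0 *: col j g.

Let measurable_lin n v g s : measurable_fun setT
  (fun x => (enorm (@lin n v g s x) ^+ 2)%:E).
Proof.
apply/measurable_EFinP; apply: measurable_funX.
apply: (measurableT_comp (measurable_enorm n)); apply: measurable_mx => i k.
rewrite /lin; under eq_fun do rewrite mxE summxE.
apply: measurable_funD; first exact: measurable_cst.
apply: measurable_sum => j; under eq_fun do rewrite !mxE.
by apply: measurable_funM => //; exact: coord_measurable.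
Qed.

(* Flipping the sign of one Gaussian coordinate preserves the law, so averaging
   over the flip removes the cross terms and the coordinates can be peeled off
   one at a time. *)
Let lin_second_moment n v g s : uniq s ->
  (\int[P]_w (enorm (@lin n v g s (N w)) ^+ 2)%:E <=
   (enorm v ^+ 2 + (\sum_(j <- s) enorm (col j g) ^+ 2) * sigma ^+ 2)%:E)%E.
Proof.
elim: s => [_|j s IH /= /andP[js us]].
  rewrite big_nil mul0r addr0; under eq_integral do rewrite /lin big_nil addr0.
  by rewrite integral_cst//= probability_setT mule1.
pose a w := (enorm (lin _ v g s (N w)) ^+ 2)%:E.
pose b w := ((enorm (col j g) ^+ 2)%:E * ((N w j 0) ^+ 2)%:E)%E.
have ma : measurable_fun setT a.
  exact: (measurableT_comp (measurable_lin n v g s) mN).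
have mN2 : measurable_fun setT (fun w => ((N w j 0) ^+ 2)%:E).
  apply/measurable_EFinP; apply: measurable_funX.
  exact: (measurableT_comp (coord_measurable m 1 j 0) mN).
have mb : measurable_fun setT b by exact: measurable_funeM.
set I := (\int[P]_w _)%E.
(* The integrals before and after the flip are equal, and their sum is given by the parallelogram
   identity. All terms are nonnegative, so no integrability of the cross term has to be shown. *)
have II : (2%:E * I = \int[P]_w (2%:E * (a w + b w)))%E.
  have flipE : I = (\int[P]_w (enorm (lin _ v g (j :: s) (flip j (N w))) ^+ 2)%:E)%E.
    rewrite (gaussian_flip j (fun x => (enorm (lin _ v g (j :: s) x) ^+ 2)%:E))//.
    by move=> x; rewrite lee_fin sqr_ge0.
  rewrite -[2]/(1 + 1) EFinD ge0_muleDl// mul1e {2}flipE.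
  rewrite -ge0_integralD//; last 4 first.
  - by move=> w _; rewrite lee_fin sqr_ge0.
  - exact: (measurableT_comp (measurable_lin n v g (j :: s)) mN).
  - by move=> w _; rewrite lee_fin sqr_ge0.
  - apply: (measurableT_comp (measurable_lin n v g (j :: s))).
    by apply: measurableT_comp => //; exact: measurable_flip.
  apply: eq_integral => w _; rewrite /a /b. rewrite -!(EFinM,EFinD); congr EFin.
  have -> : lin _ v g (j :: s) (N w) = lin _ v g s (N w) + N w j 0 *: col j g.
    by rewrite /lin big_cons addrCA addrC.
  have -> : lin _ v g (j :: s) (flip j (N w)) = lin _ v g s (N w) - N w j 0 *: col j g.
    rewrite /lin big_cons mxE eqxx scaleNr addrCA addrC; congr (_ + _ - _).
    apply: eq_big_seq => k ks; rewrite mxE ifF//; apply/eqP => kj.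
    by rewrite -kj ks in js.
  move: (lin _ v g s (N w)) => u; rewrite -scaleNr -!dotvv !(dotvDl, dotvDr, dotvZl, dotvZr).
  by rewrite (dotvC _ (col j g) u); ring.
have a0 w : (0 <= a w)%E by rewrite lee_fin sqr_ge0.
have b0 w : (0 <= b w)%E by rewrite mule_ge0 ?lee_fin ?sqr_ge0.
rewrite -(@lee_pmul2l _ 2%:E)// II ge0_integralZl//; last 2 first.
- exact: emeasurable_funD.
- by move=> w _; exact: adde_ge0.
apply: lee_wpmul2l => //; rewrite ge0_integralD// big_cons.
rewrite [leRHS](_ : _ = (enorm v ^+ 2 + (\sum_(j0 <- s) enorm (col j0 g) ^+ 2) *
  sigma ^+ 2)%:E + (enorm (col j g) ^+ 2 * sigma ^+ 2)%:E)%E; last first.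
  by rewrite -EFinD; congr EFin; ring.
apply: leeD; first exact: (IH us).
rewrite ge0_integralZl//; last first.
- by rewrite lee_fin sqr_ge0.
- by move=> w _; rewrite lee_fin sqr_ge0.
rewrite (EFinM (enorm (col j g) ^+ 2)) /b.
apply: lee_wpmul2l; first by rewrite lee_fin sqr_ge0.
exact: gaussian_second_moment.
Qed.

Lemma gaussian_affine_second_moment n (v : 'cV[R]_n) (g : 'M[R]_(n, m)) :
  (\int[P]_w (enorm (v + g *m N w) ^+ 2)%:E <=
   (enorm v ^+ 2 + enorm g ^+ 2 * sigma ^+ 2)%:E)%E.
Proof.
have := lin_second_moment n v g _ (index_enum_uniq 'I_m).
rewrite (_ : \sum_(j <- _) _ = enorm g ^+ 2); last first.
  rewrite sqr_enorm exchange_big/=; apply: eq_bigr => j _.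
  by rewrite enorm_col; apply: eq_bigr => i _; rewrite mxE.
apply: le_trans; rewrite le_eqVlt; apply/orP; left; apply/eqP.
apply: eq_integral => w _; rewrite /lin; congr (enorm (_ + _) ^+ 2)%:E.
apply/matrixP => i k; rewrite (ord1 k) mxE summxE; apply: eq_bigr => j _.
by rewrite !mxE mulrC.
Qed.

End gaussian_vector.

(** * Increments of the driving processes *)

Lemma measurable_subv {R : realType} d (T : measurableType d) (n : nat)
    (f g : T -> 'cV[R]_n) :
  measurable_fun setT f -> measurable_fun setT g ->
  measurable_fun setT (fun w => f w - g w).
Proof.
move=> mf mg; apply: measurable_mx => i j; under eq_fun do rewrite !mxE.
by apply: measurable_funB; apply: (measurableT_comp (coord_measurable n 1 i j)).
Qed.

Section independent_noise.
Context {R : realType} {disp} {Omega : measurableType disp} (P : probability Omega R)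
  {d m : nat}.
Variables (B : R -> Omega -> 'cV[R]_m) (L : R -> Omega -> 'cV[R]_d) (dt : R).
Hypothesis HBM : brownian_motion P B.
Hypothesis HL : levy_process P L.
Hypothesis HBL : independent_processes P B L.
Hypothesis dt0 : 0 < dt.

Definition grid_increment n (X : R -> Omega -> 'cV[R]_n) (i : nat) (w : Omega) : 'cV[R]_n :=
  X (i.+1%:R * dt) w - X (i%:R * dt) w.

Local Notation dB := (grid_increment m B).
Local Notation dL := (grid_increment d L).

Definition noise (i : nat) (w : Omega) := (dB i w, dL i w).

Let grid_ge0 i : 0 <= i%:R * dt. Proof. by rewrite mulr_ge0// ltW. Qed.

Let grid_step i : i.+1%:R * dt - i%:R * dt = dt.
Proof. by rewrite -mulrBl -natrB// subSnn mul1r. Qed.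

Lemma measurable_dB i : measurable_fun setT (dB i).
Proof. by apply: measurable_subv; apply: (bm_measurable HBM). Qed.

Lemma measurable_dL i : measurable_fun setT (dL i).
Proof. by apply: measurable_subv; apply: (levy_measurable HL). Qed.

Lemma measurable_noise i : measurable_fun setT (noise i).
Proof. by apply: measurable_fun_pair; [exact: measurable_dB|exact: measurable_dL]. Qed.

Let process_sigma_increments n (X : R -> Omega -> 'cV[R]_n) (A : nat -> set 'cV[R]_n) k :
  (forall i, measurable (A i)) ->
  process_sigma X (\bigcap_(i in [set i | (i < k)%N]) grid_increment n X i @^-1` A i).
Proof.
move=> mA.
pose G := \bigcup_(t in [set t : R | 0 <= t]) preimage_set_system setT (X t) measurable.
have mX t : 0 <= t -> measurable_fun setT (X t : g_sigma_algebraType G -> 'cV[R]_n).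
  move=> t0 _ D mD; apply: sub_sigma_algebra; exists t => //.
  by exists D.
apply: (@bigcap_measurableType _ (g_sigma_algebraType G)) => i _.
have := measurable_subv _ (g_sigma_algebraType G) n _ _
  (mX _ (grid_ge0 i.+1)) (mX _ (grid_ge0 i)).
by move=> /(_ measurableT _ (mA i)); rewrite setTI.
Qed.

Let bigcap_ord (k : nat) (E : nat -> set Omega) :
  \bigcap_(i in [set i | (i < k)%N]) E i = \bigcap_(i in [set: 'I_k]) E i.
Proof.
apply/seteqP; split=> w Ew i; first by move=> _; apply: Ew => /=.
by move=> /= ik; exact: (Ew (Ordinal ik)).
Qed.

Let prob_increments n (X : R -> Omega -> 'cV[R]_n) (A : nat -> set 'cV[R]_n) k :
  independent_increments P X -> (forall i, measurable (A i)) ->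
  P (\bigcap_(i in [set i | (i < k)%N]) grid_increment n X i @^-1` A i) =
  (\prod_(i < k) P (grid_increment n X i @^-1` A i))%E.
Proof.
move=> iX mA; rewrite bigcap_ord.
apply: (iX k (fun i => i%:R * dt) (grid_ge0 0%N) _ (fun i : 'I_k => A i)) => // i _.
by rewrite ler_wpM2r ?ler_nat// ltW.
Qed.

Let cylinder (A : nat -> set 'cV[R]_m) (C : nat -> set 'cV[R]_d) (k : nat) :=
  \bigcap_(i in [set i | (i < k)%N]) (dB i @^-1` A i `&` dL i @^-1` C i).

Let prob_cylinder A C k : (forall i, measurable (A i)) -> (forall i, measurable (C i)) ->
  P (cylinder A C k) =
  (\prod_(i < k) P (dB i @^-1` A i) * \prod_(i < k) P (dL i @^-1` C i))%E.
Proof.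
move=> mA mC; rewrite /cylinder bigcapI.
rewrite HBL; [|exact: process_sigma_increments|exact: process_sigma_increments].
by rewrite !prob_increments//; [exact: (levy_increments HL)|exact: (bm_increments HBM)].
Qed.

Let prob_slice k A C : measurable A -> measurable C ->
  P (dB k @^-1` A `&` dL k @^-1` C) = (P (dB k @^-1` A) * P (dL k @^-1` C))%E.
Proof.
move=> mA mC.
have slice n (X : R -> Omega -> 'cV[R]_n) (D : set 'cV[R]_n) : measurable D ->
    process_sigma X (grid_increment n X k @^-1` D).
  move=> mD; have := process_sigma_increments n X
    (fun i => if i == k then D else setT) k.+1.
  rewrite (_ : \bigcap_(i in _) _ = grid_increment n X k @^-1` D); first apply.
    by move=> i; case: ifP.
  apply/seteqP; split=> w /=; first by move=> /(_ k (ltnSn k)); rewrite /= eqxx.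
  by move=> Dw i _ /=; case: eqP => // ->.
by rewrite HBL//; exact: slice.
Qed.

Let cyl_system (k : nat) : set (set Omega) :=
  [set E | exists A C, [/\ forall i, measurable (A i), forall i, measurable (C i) &
     E = cylinder A C k]].

Let slice_system (k : nat) : set (set Omega) :=
  [set E | exists A C, [/\ measurable A, measurable C &
     E = dB k @^-1` A `&` dL k @^-1` C]].

Let mB k A : measurable A -> measurable (dB k @^-1` A).
Proof. by move=> mA; rewrite -[X in measurable X]setTI; exact: measurable_dB. Qed.

Let mL k A : measurable A -> measurable (dL k @^-1` A).
Proof. by move=> mA; rewrite -[X in measurable X]setTI; exact: measurable_dL. Qed.

Let noise_sigma (G : set (set Omega)) k :
  (forall A, measurable A -> <<s G >> (dB k @^-1` A)) ->
  (forall C, measurable C -> <<s G >> (dL k @^-1` C)) ->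
  forall D, measurable D -> <<s G >> (noise k @^-1` D).
Proof.
move=> GB GL D mD.
have : measurable_fun setT (noise k : g_sigma_algebraType G -> _).
  by apply: measurable_fun_pair => _ A mA; rewrite setTI; [exact: GB|exact: GL].
by move=> /(_ measurableT _ mD); rewrite setTI.
Qed.

Let past_cylinder k j D : (j < k)%N -> measurable D ->
  <<s cyl_system k >> (noise j @^-1` D).
Proof.
move=> jk mD; apply: noise_sigma => // A mA; apply: sub_sigma_algebra.
  exists (fun i => if i == j then A else setT), (fun=> setT); split => //.
    by move=> i; case: ifP.
  apply/seteqP; split=> w /=.
    by move=> Aw i _; split => //=; case: eqP => // ->.
  by move=> /(_ j jk)[]; rewrite /= eqxx.
exists (fun=> setT), (fun i => if i == j then A else setT); split => //.
  by move=> i; case: ifP.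
apply/seteqP; split=> w /=.
  by move=> Aw i _; split => //=; case: eqP => // ->.
by move=> /(_ j jk)[]; rewrite /= eqxx.
Qed.

(** Cylinders of past increments and rectangles in the current ones are pi-systems generating enough
    events. On them the product rule follows from the independence of [B] and [L] together with the
    independence of the increments of each. *)
Lemma noise_independent k A D : <<s past noise k >> A -> measurable D ->
  P (A `&` noise k @^-1` D) = (P A * P (noise k @^-1` D))%E.
Proof.
move=> pA mD; apply: (independent_sigma P (cyl_system k) (slice_system k)).
- move=> _ _ [A1 [C1 [mA1 mC1 ->]]] [A2 [C2 [mA2 mC2 ->]]].
  exists (fun i => A1 i `&` A2 i), (fun i => C1 i `&` C2 i); split.
  + by move=> i; exact: measurableI.
  + by move=> i; exact: measurableI.
  + rewrite /cylinder -bigcapI; apply: eq_bigcapr => i _.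
    by rewrite !preimage_setI setIACA.
- exists (fun=> setT), (fun=> setT); split => //; apply/seteqP; split => //.
- move=> _ [A1 [C1 [mA1 mC1 ->]]]; apply: bigcap_measurableType => i _.
  by apply: measurableI; [exact: mB|exact: mL].
- move=> _ _ [A1 [C1 [mA1 mC1 ->]]] [A2 [C2 [mA2 mC2 ->]]].
  exists (A1 `&` A2), (C1 `&` C2); split; [exact: measurableI|exact: measurableI|].
  by rewrite !preimage_setI setIACA.
- by exists setT, setT; split => //; rewrite !preimage_setT setIT.
- move=> _ [A1 [C1 [mA1 mC1 ->]]].
  by apply: measurableI; [exact: mB|exact: mL].
- move=> _ _ [A1 [C1 [mA1 mC1 ->]]] [A2 [C2 [mA2 mC2 ->]]].
  (* A cylinder of length [k] does not constrain slot [k], so the rectangle is stored there: the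
     intersection is a cylinder of length [k.+1], whose probability factors. *)
  pose A3 i := if i == k then A2 else A1 i.
  pose C3 i := if i == k then C2 else C1 i.
  have A3k : A3 k = A2 by rewrite /A3 eqxx.
  have C3k : C3 k = C2 by rewrite /C3 eqxx.
  have A3E (i : 'I_k) : A3 i = A1 i by rewrite /A3 ltn_eqF.
  have C3E (i : 'I_k) : C3 i = C1 i by rewrite /C3 ltn_eqF.
  have -> : cylinder A1 C1 k `&` (dB k @^-1` A2 `&` dL k @^-1` C2) = cylinder A3 C3 k.+1.
    apply/seteqP; split=> w.
      move=> [w1 w2] i /=; rewrite ltnS leq_eqVlt => /predU1P[->|ik].
        by rewrite A3k C3k.
      by have := w1 i ik; rewrite /= -(A3E (Ordinal ik)) -(C3E (Ordinal ik)).
    move=> w3; split; last by have := w3 k (ltnSn k); rewrite A3k C3k.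
    move=> i ik; have := w3 i (ltnW ik).
    by rewrite (A3E (Ordinal ik)) (C3E (Ordinal ik)).
  rewrite !prob_cylinder//; last 2 first.
  + by move=> i; rewrite /A3; case: ifP.
  + by move=> i; rewrite /C3; case: ifP.
  rewrite prob_slice// !big_ord_recr/= A3k C3k muleACA; congr (_ * _ * _)%E.
  + by apply: eq_bigr => i _; rewrite A3E.
  + by apply: eq_bigr => i _; rewrite C3E.
- move: A pA; apply: smallest_sub; first exact: smallest_sigma_algebra.
  move=> _ [j jk [D' mD' <-]]; rewrite setTI; exact: past_cylinder.
- apply: noise_sigma => // E mE; apply: sub_sigma_algebra.
  + by exists E, setT; split => //; rewrite preimage_setT setIT.
  + by exists setT, E; split => //; rewrite preimage_setT setTI.
Qed.

Lemma dB_box_law k (A : 'I_m -> set R) : (forall j, measurable (A j)) ->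
  P [set w | forall j, A j (dB k w j 0)] =
  (\prod_(j < m) normal_prob 0 (Num.sqrt dt) (A j))%E.
Proof.
move=> mA; have kk : k%:R * dt < k.+1%:R * dt by rewrite ltr_pM2r// ltr_nat.
by have := bm_gaussian HBM (grid_ge0 k) kk mA; rewrite grid_step.
Qed.

Let dB_law k A : measurable A -> P (dB k @^-1` A) = P (dB 0%N @^-1` A).
Proof.
move=> mA.
pose Y j : {mfun Omega >-> 'cV[R]_m} :=
  HB.pack (dB j) (isMeasurableFun.Build _ _ _ _ _ (measurable_dB j)).
apply: (box_law_unique m (distribution P (Y k)) (distribution P (Y 0%N))) => // A' mA'.
exact: (etrans (dB_box_law k A' mA') (esym (dB_box_law 0%N A' mA'))).
Qed.

Let dL_law k A : measurable A -> P (dL k @^-1` A) = P (dL 0%N @^-1` A).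
Proof.
move=> mA; rewrite /grid_increment.
have st i : P [set w | A (L (i.+1%:R * dt) w - L (i%:R * dt) w)] =
    P [set w | A (L dt w)].
  have ii : i%:R * dt <= i.+1%:R * dt by rewrite ler_pM2r// ler_nat.
  by have := levy_stationary HL (grid_ge0 i) ii mA; rewrite grid_step.
exact: (etrans (st k) (esym (st 0%N))).
Qed.

(** On rectangles the probability is the product of the marginal ones, and these do not depend on
    [k]: the Brownian part by its Gaussian law on boxes, the Levy part by stationarity. *)
Lemma noise_law k D : measurable D -> P (noise k @^-1` D) = P (noise 0%N @^-1` D).
Proof.
move=> mD.
pose Y j : {mfun Omega >-> ('cV[R]_m * 'cV[R]_d)%type} :=
  HB.pack (noise j) (isMeasurableFun.Build _ _ _ _ _ (measurable_noise j)).
pose G : set (set ('cV[R]_m * 'cV[R]_d)) :=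
  [set A `*` C | A in measurable & C in measurable].
refine (@measure_unique _ R ('cV[R]_m * 'cV[R]_d)%type G (fun=> setT) _ _ _ _
  (distribution P (Y k)) (distribution P (Y 0%N)) _ _ D mD).
- exact: measurable_prod_measurableType.
- move=> _ _ [A1 mA1 [C1 mC1 <-]] [A2 mA2 [C2 mC2 <-]].
  by rewrite -setXI; exists (A1 `&` A2); [exact: measurableI|
    exists (C1 `&` C2) => //; exact: measurableI].
- by move=> _; exists setT => //; exists setT => //; rewrite setXTT.
- by rewrite bigcup_const.
- move=> _ [A mA [C mC <-]]; rewrite /distribution/= /pushforward/=.
  transitivity (P (dB k @^-1` A) * P (dL k @^-1` C))%E; first exact: prob_slice.
  by rewrite dB_law// dL_law//; apply/esym; exact: prob_slice.
- move=> j; exact: le_lt_trans (probability_le1 (distribution P (Y k)) measurableT) (ltry _).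
Qed.

End independent_noise.

(** * The implicit step *)

Section implicit_step.
Context {R : realType} {d m : nat}.
Variables (f : 'cV[R]_d -> 'cV[R]_d) (g : 'cV[R]_d -> 'M[R]_(d, m)) (K3 K4 dt : R).
Hypothesis HK3 : K3 < - 2^-1.
Hypothesis HK4 : 0 < K4.
Hypothesis Hf : forall x y : 'cV[R]_d,
  dotv (x - y) (f x - f y) <= K3 * enorm (x - y) ^+ 2.
Hypothesis Hg : forall x y : 'cV[R]_d,
  enorm (g x - g y) ^+ 2 <= K4 * enorm (x - y) ^+ 2.
Hypothesis dt0 : 0 < dt.

Local Notation kappa := (1 - dt * K3).

Let kappa0 : 0 < kappa.
Proof.
have K30 : K3 < 0 by rewrite (lt_trans HK3)// oppr_lt0 invr_gt0.
by rewrite subr_gt0 (lt_trans _ ltr01)// pmulr_rlt0.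
Qed.

Definition implicit_residual (z : 'cV[R]_d) : 'cV[R]_d := z - dt *: f z.
Local Notation S := implicit_residual.

(** With a = |z - z'|, Cauchy-Schwarz bounds a |S z - S z'| below by (z - z').(S z - S z'), which is
    at least (1 - dt K3) a^2; then divide by a. *)
Lemma implicit_residual_expansive z z' : enorm (z - z') <= kappa^-1 * enorm (S z - S z').
Proof.
rewrite mulrC ler_pdivlMr//.
have := cauchy_schwarz _ (z - z') (S z - S z').
have -> : S z - S z' = (z - z') + (- dt) *: (f z - f z').
  by apply/matrixP => i j; rewrite !mxE; ring.
rewrite dotvDr dotvv dotvZr.
have := Hf z z'; have := enorm_ge0 _ _ (z - z').
have := enorm_ge0 _ _ (z - z' + - dt *: (f z - f z')).
set a := enorm (z - z'); set u := enorm (z - z' + _).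
set p := dotv _ (f z - f z') => u0 a0 hp h.
have [->|an0] := eqVneq a 0; first by rewrite mul0r.
rewrite -(@ler_pM2l _ a) ?lt0r ?an0//.
have : 0 <= dt * (K3 * a ^+ 2 - p) by rewrite mulr_ge0 ?subr_ge0// ltW.
by move: h; rewrite !expr2; lra.
Qed.

(** The infimum is meaningful only for a set bounded below; expansivity compares z with 0 and
    supplies the bound. *)
Let lb k y : has_lbound
  (range (fun z : 'cV[R]_d => z k 0 + kappa^-1 * enorm (y - S z))).
Proof.
exists ((0 : 'cV[R]_d) k 0 - kappa^-1 * enorm (y - S 0)) => _ [z _ <-].
rewrite lerBlDr -addrA -mulrDr addrC -lerBlDr.
have h := ler_enorm _ _ (0 - z) k 0; rewrite !mxE in h *.
apply: (le_trans (ler_norm _)); apply: (le_trans h).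
apply: (le_trans (implicit_residual_expansive _ _)).
apply: ler_wpM2l; first by rewrite invr_ge0 ltW.
have := enorm_triangle _ (S 0 - y) (y - S z).
by rewrite subrKA (enormB _ _ (S 0) y) [leRHS]addrC.
Qed.

(* A Lipschitz left inverse of the residual map, defined on the whole space
   although the residual map need not be onto since [f] may be discontinuous
   (McShane extension, coordinate by coordinate). *)
Definition implicit_solve (y : 'cV[R]_d) : 'cV[R]_d :=
  \col_k inf_convolution d (fun z : 'cV[R]_d => z k 0) S kappa^-1 y.

(** By expansivity the k-th coordinate of z is a Lipschitz function of [S z] with constant 1/kappa.
    McShane's formula with that constant therefore reproduces the data. *)
Lemma implicit_solveK : cancel S implicit_solve.
Proof.
move=> z; apply/matrixP => k j; rewrite (ord1 j) mxE; apply/eqP.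
rewrite eq_le; apply/andP; split.
  apply: (le_trans (inf_convolution_le _ _ _ _ (lb k) _ z)).
  by rewrite subrr enorm0 mulr0 addr0.
apply: (le_inf_convolution _ _ _ _ z) => z'.
rewrite -lerBlDl; apply: le_trans (implicit_residual_expansive z z').
by have := ler_enorm _ _ (z - z') k 0; rewrite !mxE; apply: le_trans (ler_norm _).
Qed.

Lemma implicit_solve_lipschitz k y z :
  implicit_solve y k 0 <= implicit_solve z k 0 + kappa^-1 * enorm (y - z).
Proof.
rewrite !mxE; apply: (inf_convolution_lipschitz _ _ _ _ (lb k) 0).
by rewrite invr_ge0 ltW.
Qed.

Lemma measurable_implicit_solve : measurable_fun setT implicit_solve.
Proof.
apply: measurable_mx => k j; rewrite (ord1 j).
by apply: (enorm_lipschitz_measurable _ _ kappa^-1) => y z; exact: implicit_solve_lipschitz.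
Qed.

(** Only linear growth matters here, for integrability; summing the coordinate bounds costs the
    factor [d]. *)
Lemma enorm_implicit_solve y : enorm (implicit_solve y) <=
  \sum_(k < d) `|implicit_solve 0 k 0| + d%:R * kappa^-1 * enorm y.
Proof.
apply: (le_trans (enorm_le_sum _ _)).
have -> : d%:R * kappa^-1 * enorm y = \sum_(k < d) kappa^-1 * enorm y.
  by rewrite sumr_const card_ord -mulrA mulr_natl.
rewrite -big_split/=; apply: ler_sum => k _.
have h1 := implicit_solve_lipschitz k y 0.
have h2 := implicit_solve_lipschitz k 0 y.
rewrite subr0 in h1; rewrite sub0r enormN in h2.
rewrite -lerBlDl; apply: (le_trans (lerB_dist _ _)).
by rewrite ler_norml; apply/andP; split; lra.
Qed.

Definition em_map (z : 'cV[R]_d * ('cV[R]_m * 'cV[R]_d)) : 'cV[R]_d :=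
  implicit_solve (z.1 + g z.1 *m z.2.1 + z.2.2).

(** Any solution of the implicit equation has residual x + g(x) b + l, so the left inverse recovers
    it; in particular the solution is unique. *)
Lemma em_map_step x x' b l : x' = x + dt *: f x' + g x *m b + l -> em_map (x, (b, l)) = x'.
Proof.
move=> xE; rewrite /em_map/= -[RHS]implicit_solveK; congr implicit_solve.
apply: (canRL (addrK _)); rewrite [RHS]xE.
by rewrite addrAC; congr (_ + _); rewrite addrAC.
Qed.

Lemma measurable_em_map : measurable_fun setT em_map.
Proof.
apply: (measurableT_comp measurable_implicit_solve).
apply: measurable_mx => i j; rewrite (ord1 j).
under eq_fun do rewrite !mxE.
have mz1 : measurable_fun setT (fun z : 'cV[R]_d * ('cV[R]_m * 'cV[R]_d) => z.1).
  exact: measurable_fst.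
have mz21 : measurable_fun setT (fun z : 'cV[R]_d * ('cV[R]_m * 'cV[R]_d) => z.2.1).
  by apply: measurableT_comp => //; exact: measurable_snd.
have mz22 : measurable_fun setT (fun z : 'cV[R]_d * ('cV[R]_m * 'cV[R]_d) => z.2.2).
  by apply: measurableT_comp => //; exact: measurable_snd.
apply: measurable_funD; last exact: (measurableT_comp (coord_measurable d 1 i 0) mz22).
apply: measurable_funD; first exact: (measurableT_comp (coord_measurable d 1 i 0) mz1).
apply: measurable_sum => k; apply: measurable_funM.
  have mg : measurable_fun setT (fun x => g x i k).
    apply: (enorm_lipschitz_measurable _ _ (Num.sqrt K4)) => x y.
    rewrite -lerBlDl.
    have h := ler_enorm _ _ (g x - g y) i k; rewrite !mxE in h.
    apply: (le_trans (ler_norm _)); apply: (le_trans h).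
    rewrite -(@ler_pXn2r _ 2)// ?nnegrE ?mulr_ge0 ?sqrtr_ge0 ?enorm_ge0//.
    by rewrite exprMn (@sqr_sqrtr _ K4); [exact: Hg|exact: ltW].
  exact: (measurableT_comp mg mz1).
exact: (measurableT_comp (coord_measurable m 1 k 0) mz21).
Qed.

End implicit_step.

(** * Contraction in mean and integrability of the one-step map *)

Section contraction_in_mean.
Context {R : realType} {disp} {Omega : measurableType disp} (P : probability Omega R)
  {d m : nat}.
Variables (B : R -> Omega -> 'cV[R]_m) (L : R -> Omega -> 'cV[R]_d).
Variables (f : 'cV[R]_d -> 'cV[R]_d) (g : 'cV[R]_d -> 'M[R]_(d, m)) (K3 K4 dt : R).
Hypothesis HBM : brownian_motion P B.
Hypothesis HL : levy_process P L.
Hypothesis HLmoments : forall t p : R, 0 <= t -> 0 < p ->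
  (\int[P]_w (enorm (L t w) `^ p)%:E < +oo)%E.
Hypothesis HK3 : K3 < - 2^-1.
Hypothesis HK4 : 0 < K4.
Hypothesis Hf : forall x y : 'cV[R]_d,
  dotv (x - y) (f x - f y) <= K3 * enorm (x - y) ^+ 2.
Hypothesis Hg : forall x y : 'cV[R]_d,
  enorm (g x - g y) ^+ 2 <= K4 * enorm (x - y) ^+ 2.
Hypothesis dt0 : 0 < dt.

Local Notation kappa := (1 - dt * K3).
Local Notation xi := (noise B L dt).
Local Notation F := (em_map f g K3 dt).

Let kappa0 : 0 < kappa.
Proof.
have K30 : K3 < 0 by rewrite (lt_trans HK3)// oppr_lt0 invr_gt0.
by rewrite subr_gt0 (lt_trans _ ltr01)// pmulr_rlt0.
Qed.

Let mdB := measurable_dB P B dt HBM dt0.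
Let mdL := measurable_dL P L dt HL dt0.
Let mxi k := measurable_noise P B L dt HBM HL dt0 k.
Let mF : measurable_fun setT F.
Proof. exact: measurable_em_map HK3 HK4 Hf Hg dt0. Qed.

Let mFxi x : measurable_fun setT (fun w => F (x, xi 0%N w)).
Proof. by apply: (measurableT_comp mF); exact: measurable_fun_pair. Qed.

Let mv (v : 'cV[R]_d) (M : 'M[R]_(d, m)) :
  measurable_fun setT (fun w => (enorm (v + M *m grid_increment dt m B 0 w) ^+ 2)%:E).
Proof.
apply/measurable_EFinP; apply: measurable_funX.
apply: (measurableT_comp (measurable_enorm d)); apply: measurable_mx => i j.
under eq_fun do rewrite mxE [X in _ + X]mxE.
apply: measurable_funD; first exact: measurable_cst.
apply: measurable_sum => k; apply: measurable_funM; first exact: measurable_cst.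
exact: (measurableT_comp (coord_measurable m 1 k j) (mdB 0%N)).
Qed.

Let second_moment (v : 'cV[R]_d) (M : 'M[R]_(d, m)) :
  (\int[P]_w (enorm (v + M *m grid_increment dt m B 0 w) ^+ 2)%:E <=
   (enorm v ^+ 2 + enorm M ^+ 2 * dt)%:E)%E.
Proof.
have s0 : Num.sqrt dt != 0 by rewrite gt_eqF// sqrtr_gt0.
have := gaussian_affine_second_moment P (grid_increment dt m B 0) _ s0 (mdB 0%N)
  (dB_box_law P B dt HBM dt0 0%N) d v M.
by rewrite (@sqr_sqrtr _ dt)//; exact: ltW.
Qed.

(** Almost sure solvability at both starts allows the sharp expansivity bound on true solutions, in
    place of the coordinatewise Lipschitz bounds of the extension. *)
Lemma em_map_contraction x y :
  {ae P, forall w, exists x', x' = x + dt *: f x' + g x *m (xi 0%N w).1 + (xi 0%N w).2} ->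
  {ae P, forall w, exists y', y' = y + dt *: f y' + g y *m (xi 0%N w).1 + (xi 0%N w).2} ->
  (\int[P]_w (enorm (F (x, xi 0%N w) - F (y, xi 0%N w)))%:E <=
   ((1 + K4 * dt / 2) / kappa * enorm (x - y))%:E)%E.
Proof.
move=> solx soly; have [<-|xy] := eqVneq x y.
  rewrite subrr enorm0 mulr0; under eq_integral do rewrite subrr enorm0.
  by rewrite integral0.
pose a := enorm (x - y).
have a0 : 0 < a.
  rewrite lt0r enorm_ge0 andbT; apply: contra xy => /eqP /enorm0_eq0 /eqP.
  by rewrite subr_eq0.
pose u w := x - y + (g x - g y) *m grid_increment dt m B 0 w.
have c1 : 0 <= kappa^-1 * (a / 2) by rewrite mulr_ge0 ?invr_ge0 ?divr_ge0// ltW.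
have c2 : 0 <= kappa^-1 / (2 * a) by rewrite divr_ge0 ?invr_ge0 ?mulr_ge0// ltW.
(* The first moment of |u| is reduced to the second by |u| <= a/2 + |u|^2/(2a), where the Gaussian
   bound applies; the case a = 0 was removed beforehand. *)
apply: (@le_trans _ _ (\int[P]_w ((kappa^-1 * (a / 2))%:E +
    (kappa^-1 / (2 * a))%:E * (enorm (u w) ^+ 2)%:E))%E).
  apply: ae_ge0_le_integral => //.
  - by move=> w _; rewrite lee_fin enorm_ge0.
  - exact: measurable_enormB.
  - by move=> w _; rewrite adde_ge0 ?mule_ge0 ?lee_fin ?sqr_ge0.
  - by apply: emeasurable_funD => //; apply: measurable_funeM; exact: mv.
  apply: filterS2 solx soly => w [x' xE] [y' yE] _.
  have -> : F (x, xi 0%N w) = x' by exact: (em_map_step f g K3 dt HK3 Hf dt0 x x' _ _ xE).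
  have -> : F (y, xi 0%N w) = y' by exact: (em_map_step f g K3 dt HK3 Hf dt0 y y' _ _ yE).
  rewrite -EFinM -EFinD lee_fin.
  apply: (le_trans (implicit_residual_expansive f K3 dt HK3 Hf dt0 x' y')).
  have -> : implicit_residual f dt x' - implicit_residual f dt y' = u w.
    rewrite /implicit_residual {1}xE {1}yE /u mulmxBl.
    by apply/matrixP => i j; rewrite !mxE; ring.
  rewrite -mulrA -mulrDr ler_wpM2l ?invr_ge0 ?(ltW kappa0)//.
  rewrite -subr_ge0 (_ : _ - _ = (enorm (u w) - a) ^+ 2 / (2 * a)).
    by apply: divr_ge0; rewrite ?sqr_ge0// mulr_ge0// ltW.
  by field; rewrite gt_eqF.
rewrite ge0_integralD//; last 2 first.
- by move=> w _; rewrite mule_ge0 ?lee_fin ?sqr_ge0.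
- by apply: measurable_funeM; exact: mv.
rewrite integral_cst//= probability_setT mule1 ge0_integralZl//; last 2 first.
- exact: mv.
- by move=> w _; rewrite lee_fin sqr_ge0.
apply: (@le_trans _ _ ((kappa^-1 * (a / 2))%:E + (kappa^-1 / (2 * a))%:E *
    (a ^+ 2 + K4 * a ^+ 2 * dt)%:E)%E).
  rewrite leeD2l// lee_wpmul2l ?lee_fin//; apply: (le_trans (second_moment _ _)).
  by rewrite lee_fin lerD2l ler_wpM2r ?(ltW dt0)//; exact: Hg.
rewrite -EFinM -EFinD lee_fin le_eqVlt; apply/orP; left; apply/eqP.
by rewrite -/a; field; rewrite !gt_eqF.
Qed.

Let integrable_dL : (\int[P]_w (enorm (grid_increment dt d L 0 w))%:E < +oo)%E.
Proof.
have mL t : 0 <= t -> measurable_fun setT (fun w => (enorm (L t w))%:E).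
  move=> t0; apply/measurable_EFinP.
  exact: (measurableT_comp (measurable_enorm d) (levy_measurable HL t0)).
have fin t : 0 <= t -> (\int[P]_w (enorm (L t w))%:E < +oo)%E.
  move=> t0; have := HLmoments t 1 t0 ltr01.
  by under eq_integral do rewrite powRr1 ?enorm_ge0//.
have t1 : 0 <= 1%:R * dt by rewrite mulr_ge0// ltW.
have t0 : 0 <= 0%:R * dt by rewrite mul0r.
apply: (@le_lt_trans _ _ (\int[P]_w ((enorm (L (1%:R * dt) w))%:E +
  (enorm (L (0%:R * dt) w))%:E))%E).
  apply: ge0_le_integral => //.
  - by move=> w _; rewrite lee_fin enorm_ge0.
  - apply/measurable_EFinP; apply: (measurableT_comp (measurable_enorm d)); exact: mdL.
  - by apply: emeasurable_funD; exact: mL.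
  - move=> w _; rewrite -EFinD lee_fin -[X in _ <= _ + X]enormN.
    exact: enorm_triangle.
rewrite ge0_integralD//; [|by move=> w _; rewrite lee_fin enorm_ge0|exact: mL
  |by move=> w _; rewrite lee_fin enorm_ge0|exact: mL].
by rewrite lte_add_pinfty// fin.
Qed.

(** Linear growth of the solver reduces the claim to the second moment of the Brownian part and the
    first moment of the Levy part. *)
Lemma em_map_integrable : (\int[P]_w (enorm (F (0, xi 0%N w)))%:E < +oo)%E.
Proof.
pose M := \sum_(k < d) `|implicit_solve f K3 dt 0 k 0|.
pose c := d%:R * kappa^-1.
have c0 : 0 <= c by rewrite mulr_ge0 ?invr_ge0// ltW.
have M0 : 0 <= M by rewrite sumr_ge0.
pose v w := 0 + g 0 *m grid_increment dt m B 0 w.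
have mdL' : measurable_fun setT (fun w => (enorm (grid_increment dt d L 0 w))%:E).
  by apply/measurable_EFinP; apply: (measurableT_comp (measurable_enorm d)); exact: mdL.
have e0 w : (0 <= (enorm (v w) ^+ 2)%:E + (enorm (grid_increment dt d L 0 w))%:E)%E.
  by rewrite adde_ge0 ?lee_fin ?sqr_ge0 ?enorm_ge0.
have me : measurable_fun setT
    (fun w => (enorm (v w) ^+ 2)%:E + (enorm (grid_increment dt d L 0 w))%:E)%E.
  by apply: emeasurable_funD => //; exact: mv.
apply: (@le_lt_trans _ _ (\int[P]_w ((M + c)%:E + c%:E *
    ((enorm (v w) ^+ 2)%:E + (enorm (grid_increment dt d L 0 w))%:E)))%E).
  apply: ge0_le_integral => //.
  - by move=> w _; rewrite lee_fin enorm_ge0.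
  - by apply/measurable_EFinP; apply: (measurableT_comp (measurable_enorm d)).
  - by apply: emeasurable_funD => //; exact: measurable_funeM.
  move=> w _; rewrite -(EFinD (enorm (v w) ^+ 2)) -EFinM -EFinD lee_fin.
  apply: (le_trans (enorm_implicit_solve f K3 dt HK3 Hf dt0 _)).
  rewrite -[leRHS]addrA lerD2l.
  rewrite [leRHS](_ : _ = c * (1 + (enorm (v w) ^+ 2 +
    enorm (grid_increment dt d L 0 w)))); last by rewrite [RHS]mulrDr mulr1.
  rewrite ler_wpM2l//.
  apply: (le_trans (enorm_triangle _ _ _)); rewrite addrA lerD2r.
  (* These two squares give |v| <= 1 + |v|^2, which trades the first moment for the second. *)
  have := sqr_ge0 (enorm (v w) - 1); have := sqr_ge0 (enorm (v w)).
  rewrite -/(v w) sqrrB expr1n mulr1 -mulr_natr.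
  by move: (enorm (v w) ^+ 2) (enorm (v w)) => p q; lra.
rewrite ge0_integralD//; last 3 first.
- by move=> w _; rewrite lee_fin addr_ge0.
- by move=> w _; rewrite mule_ge0.
- exact: measurable_funeM.
rewrite integral_cst//= probability_setT mule1 ge0_integralZl//.
rewrite lte_add_pinfty ?ltry// lte_mul_pinfty// ge0_integralD//; last 3 first.
- by move=> w _; rewrite lee_fin sqr_ge0.
- exact: mv.
- by move=> w _; rewrite lee_fin enorm_ge0.
rewrite lte_add_pinfty//; exact: le_lt_trans (second_moment _ _) (ltry _).
Qed.

End contraction_in_mean.

Theorem theorem13 (R : realType) (disp : measure_display)
  (Omega : measurableType disp) (P : probability Omega R) (d m : nat)
  (B : R -> Omega -> 'cV[R]_m) (L : R -> Omega -> 'cV[R]_d)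
  (nu : {measure set 'cV[R]_d -> \bar R}) (gamma0 gammaoo : R)
  (HBM : brownian_motion P B)
  (HL : levy_process P L)
  (HBL : independent_processes P B L)
  (Hnu : levy_measure nu)
  (Htriplet : levy_triplet00 P L nu)
  (Hgamma0 : 1 <= gamma0 <= 2)
  (Hnu0 : (\int[nu]_(z in [set z : 'cV[R]_d | z != 0%R /\ (enorm z < 1)%R])
             (enorm z `^ gamma0)%:E < +oo)%E)
  (Hgammaoo : 1 < gammaoo)
  (Hnuoo : (\int[nu]_(z in [set z : 'cV[R]_d | (1 <= enorm z)%R])
             (enorm z `^ gammaoo)%:E < +oo)%E)
  (HLmoments : forall (t p : R), 0 <= t -> 0 < p ->
     (\int[P]_w (enorm (L t w) `^ p)%:E < +oo)%E)
  (HLmean : forall (t : R) (j : 'I_d), 0 <= t ->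
     ('E_P[fun w => L t w j 0%R] = 0)%E)
  (f : 'cV[R]_d -> 'cV[R]_d) (g : 'cV[R]_d -> 'M[R]_(d, m)) (K3 K4 : R)
  (HK3 : K3 < - 2^-1) (HK4 : 0 < K4) (HK34 : K4 + 2 * K3 < -1)
  (Hf : forall x y : 'cV[R]_d,
     dotv (x - y) (f x - f y) <= K3 * enorm (x - y) ^+ 2)
  (Hg : forall x y : 'cV[R]_d,
     enorm (g x - g y) ^+ 2 <= K4 * enorm (x - y) ^+ 2)
  (dt : R) (Hdt : 0 < dt < 1)
  (X : 'cV[R]_d -> nat -> Omega -> 'cV[R]_d)
  (HX : forall x : 'cV[R]_d, semi_implicit_EM P f g B L dt x (X x)) :
  exists Pi : probability 'cV[R]_d R,
    invariant_measure (transition P X) Pi /\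
    (forall Pi' : probability 'cV[R]_d R,
       invariant_measure (transition P X) Pi' ->
       forall A : set 'cV[R]_d, measurable A -> Pi' A = Pi A).
Proof.
have /andP[dt0 _] := Hdt.
have K30 : K3 < 0 by rewrite (lt_trans HK3)// oppr_lt0 invr_gt0.
have kappa0 : 0 < 1 - dt * K3 by rewrite subr_gt0 (lt_trans _ ltr01)// pmulr_rlt0.
pose xi := noise B L dt; pose F := em_map f g K3 dt.
pose s := (1 + K4 * dt / 2) / (1 - dt * K3).
have s01 : 0 <= s < 1.
  rewrite /s divr_ge0 ?(ltW kappa0)//=; last by rewrite addr_ge0// divr_ge0// mulr_ge0// ltW.
  (* After cancelling 1 and [dt], the claim s < 1 reads K4/2 < - K3, a consequence of [HK34]. *)
  rewrite ltr_pdivrMr// mul1r ltrD2l -mulrN (mulrC K4) -mulrA ltr_pM2l//.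
  by lra.
have mxi := measurable_noise P B L dt HBM HL dt0.
have mF : measurable_fun setT F by exact: measurable_em_map HK3 HK4 Hf Hg dt0.
have xi_law := noise_law P B L dt HBM HL HBL dt0.
have xi_indep := noise_independent P B L dt HBM HL HBL dt0.
have step x i : {ae P, forall w, F (X x i w, xi i w) = X x i.+1 w}.
  apply: filterS (em_step (HX x) i) => w.
  exact: (em_map_step f g K3 dt HK3 Hf dt0).
(* The implicit equation started at x is solvable almost surely because the given chain [X x] takes
   such a step at time 0. *)
have sol x : {ae P, forall w, exists x',
    x' = x + dt *: f x' + g x *m (xi 0%N w).1 + (xi 0%N w).2}.
  apply: filterS2 (em_start (HX x)) (em_step (HX x) 0%N) => w X0 X1.
  by exists (X x 1%N w); rewrite {1}X1 X0.
have contr x y := em_map_contraction P B L f g K3 K4 dt HBM HL HK3 HK4 Hf Hg dt0 x y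
  (sol x) (sol y).
have F0 := em_map_integrable P B L f g K3 K4 dt HBM HL HLmoments HK3 HK4 Hf Hg dt0.
have XF x i : {ae P, forall w, X x i w = forward xi F i x w}.
  elim: i => [|i IH]; first exact: em_start (HX x).
  by apply: filterS2 IH (step x i) => w Xw Fw /=; rewrite -Xw Fw.
(* This equality holds for every x, although the null set depends on x, because the kernel involves
   a single start. It also brings the measurability in x of the iterates to the kernel. *)
have transE i x A : measurable A ->
    transition P X i x A = iter i (one_step P xi F) (EFin \o \1_A) x.
  move=> mA; have m1A : measurable_fun setT (EFin \o (\1_A : 'cV[R]_d -> R)).
    by apply/measurable_EFinP; exact: measurable_indic.
  rewrite -(integral_forward P xi F mxi mF xi_law xi_indep)//; last first.
    by move=> y; rewrite lee_fin.
  have mXA : measurable (X x i @^-1` A).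
    by rewrite -[Y in measurable Y]setTI; apply: (em_measurable (HX x) i).
  rewrite /transition -[X x i @^-1` A]setIT -integral_indic//.
  apply: ge0_ae_eq_integral => //.
  - by apply/measurable_EFinP; exact: measurable_indic.
  - apply: (measurableT_comp m1A).
    exact: measurable_forward mxi mF i x.
  - by move=> w _; rewrite /= lee_fin.
  by move: (XF x i); apply: filterS => w Xw _ /=; rewrite -Xw !indicE.
have [Pi [Pi_inv Pi_uniq]] :=
  unique_stationary P xi F s mxi mF xi_law xi_indep s01 contr F0.
exists Pi; split=> [i A mA|Pi' Pi'inv A mA].
  by rewrite (Pi_inv i)//; apply: eq_integral => x _; rewrite transE.
(* The one-step instance of the invariance of [Pi'] is the stationarity condition of the uniqueness
   statement. *)
apply: Pi_uniq => // A' mA'; rewrite (Pi'inv 1%N)//.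
by apply: eq_integral => x _; rewrite transE.
Qed.
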